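(* For $\varepsilon>0$ let $(u_1^\varepsilon,u_2^\varepsilon)$ be the solution of the Dirichlet problem $$u_1^\varepsilon+H_1\big(\tfrac{x}{\varepsilon},Du_1^\varepsilon\big)+\tfrac1\varepsilon(u_1^\varepsilon-u_2^\varepsilon)=0,\qquad u_2^\varepsilon+H_2\big(\tfrac{x}{\varepsilon},Du_2^\varepsilon\big)+\tfrac1\varepsilon(u_2^\varepsilon-u_1^\varepsilon)=0\quad\text{in }\Omega,$$ $u_i^\varepsilon=g_i$ on $\partial\Omega$ for $i=1,2$, where the boundary conditions are understood in the viscosity sense. Then, as $\varepsilon\to0$, $u_1^\varepsilon$ and $u_2^\varepsilon$ converge locally uniformly on $\Omega$ to the same limit $u$, and $u$ solves $$\begin{cases}u+\overline{H}(Du)=0&\text{in }\Omega,\\ u=\overline{g}&\text{on }\partial\Omega\end{cases}$$ with the boundary condition understood in the viscosity sense, where $\overline{g}:=\min\{g_1,g_2\}$ on $\partial\Omega$.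
   Context: $\Omega\subset\mathbb{R}^n$ is a bounded domain with Lipschitz boundary and $g_1,g_2\in C(\partial\Omega)$. The Hamiltonians $H_1,H_2:\mathbb{R}^n\times\mathbb{R}^n\to\mathbb{R}$, $(\xi,p)\mapsto H_i(\xi,p)$, are continuous, satisfy the coercivity condition $\lim_{r\to\infty}\inf\{H_i(\xi,p):\xi\in\mathbb{R}^n,\ |p|\ge r\}=\infty$, and are periodic in $\xi$: $H_i(\xi+z,p)=H_i(\xi,p)$ for all $\xi,p\in\mathbb{R}^n$, $z\in\mathbb{Z}^n$. Dirichlet conditions in the viscosity sense: write $F_i[u_1,u_2,\phi](x)=u_i(x)+H_i(x/\varepsilon,D\phi(x))+\frac1\varepsilon(u_i(x)-u_j(x))$, $\{i,j\}=\{1,2\}$. A pair $(u_1,u_2)\in C(\overline\Omega)^2$ is a solution if for every $i$, $\phi\in C^1(\overline\Omega)$ and $x_0\in\overline\Omega$: (sub) if $u_i-\phi$ attains its maximum over $\overline\Omega$ at $x_0$, then $F_i[u_1,u_2,\phi](x_0)\le0$, or ($x_0\in\partial\Omega$ and $u_i(x_0)\le g_i(x_0)$); (super) if $u_i-\phi$ attains its minimum over $\overline\Omega$ at $x_0$, then $F_i[u_1,u_2,\phi](x_0)\ge0$, or ($x_0\in\partial\Omega$ and $u_i(x_0)\ge g_i(x_0)$). Solutions of the scalar limit problem are defined in the same way, $u$ being extended continuously to $\overline\Omega$. The comparison principle for these problems is taken as known, and ''the solution'' is the unique solution it provides. Effective Hamiltonian: for each $P\in\mathbb{R}^n$ it is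 known that there is a unique constant $\overline{H}(P)$ such that the cell problem $$H_1(\xi,P+Dv_1(\xi))+v_1(\xi)-v_2(\xi)=\overline{H}(P),\qquad H_2(\xi,P+Dv_2(\xi))+v_2(\xi)-v_1(\xi)=\overline{H}(P)\quad\text{in }\mathbb{R}^n$$ admits a $\mathbb{Z}^n$-periodic continuous viscosity solution $(v_1,v_2)$. *)

(* Defs.v *)
From HB Require Import structures.
From mathcomp Require Import all_boot all_order all_algebra.
From mathcomp Require Import all_classical all_reals all_analysis.

Set Implicit Arguments.
Unset Strict Implicit.
Unset Printing Implicit Defensive.

Import Order.TTheory GRing.Theory Num.Theory.
Import numFieldNormedType.Exports.

Local Open Scope classical_set_scope.
Local Open Scope ring_scope.

Definition dotv (R : realType) (n : nat) (x y : 'rV[R]_n) : R :=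
  \sum_(i < n) x 0 i * y 0 i.

(* The library's norm `|x| on row vectors is the sup norm. *)
Definition enorm (R : realType) (n : nat) (x : 'rV[R]_n) : R :=
  Num.sqrt (dotv x x).

Definition grad (R : realType) (n : nat) (phi : 'rV[R]_n -> R) (x : 'rV[R]_n)
  : 'rV[R]_n := \row_(i < n) 'D_(delta_mx 0 i) phi x.

(* Only used for open sets, for which this is the topological boundary. *)
Definition boundary (R : realType) (n : nat) (Om : set 'rV[R]_n)
  : set 'rV[R]_n := closure Om `\` Om.

(* In a neighbourhood of every boundary point, the set is the strict epigraph,
   in the direction of a unit vector e, of a Lipschitz function on the
   hyperplane orthogonal to e. As every Lipschitz function on the hyperplane
   extends to the whole space, gamma is taken defined everywhere; only its
   values on the hyperplane are used. *)
Definition lipschitz_boundary (R : realType) (n : nat) (Om : set 'rV[R]_n)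
  : Prop :=
  forall z, boundary Om z ->
    exists (e : 'rV[R]_n) (gamma : 'rV[R]_n -> R),
      [/\ enorm e = 1, lipschitz gamma &
          \forall x \near z,
            Om x <-> gamma (x - dotv x e *: e) < dotv x e].

Definition lipschitz_domain (R : realType) (n : nat) (Om : set 'rV[R]_n)
  : Prop :=
  [/\ open Om, connected Om, Om !=set0, bounded_set Om
    & lipschitz_boundary Om].

Definition coercive (R : realType) (n : nat) (H : 'rV[R]_n -> 'rV[R]_n -> R)
  : Prop :=
  ereal_inf [set h | exists xi p, r <= enorm p /\ h = (H xi p)%:E]
    @[r --> +oo%R] --> +oo%E.

Definition Zperiodic (R : realType) (n : nat) (T : Type) (f : 'rV[R]_n -> T)
  : Prop :=
  forall (xi : 'rV[R]_n) (z : 'rV[int]_n), f (xi + map_mx intr z) = f xi.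

Definition hamiltonian (R : realType) (n : nat)
    (H : 'rV[R]_n -> 'rV[R]_n -> R) : Prop :=
  [/\ continuous (fun q : 'rV[R]_n * 'rV[R]_n => H q.1 q.2),
      coercive H & Zperiodic H].

(* phi is in C^1 of the closure of Om: phi and its gradient on Om extend
   continuously to the closure, Dphi being the extension of the gradient. *)
Definition C1_closure (R : realType) (n : nat) (Om : set 'rV[R]_n)
    (phi : 'rV[R]_n -> R) (Dphi : 'rV[R]_n -> 'rV[R]_n) : Prop :=
  [/\ {within closure Om, continuous phi},
      {within closure Om, continuous Dphi} &
      forall x, Om x -> differentiable phi x /\ grad phi x = Dphi x].

(* The equation is F(x, u(x), Du(x)) = 0 in Om, with u = g on the boundary in
   the viscosity sense. *)
Definition dirichlet_sub (R : realType) (n : nat) (Om : set 'rV[R]_n)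
    (F : 'rV[R]_n -> R -> 'rV[R]_n -> R) (g u : 'rV[R]_n -> R) : Prop :=
  forall phi Dphi x0, C1_closure Om phi Dphi -> closure Om x0 ->
    (forall x, closure Om x -> u x - phi x <= u x0 - phi x0) ->
    F x0 (u x0) (Dphi x0) <= 0 \/ (boundary Om x0 /\ u x0 <= g x0).

Definition dirichlet_super (R : realType) (n : nat) (Om : set 'rV[R]_n)
    (F : 'rV[R]_n -> R -> 'rV[R]_n -> R) (g u : 'rV[R]_n -> R) : Prop :=
  forall phi Dphi x0, C1_closure Om phi Dphi -> closure Om x0 ->
    (forall x, closure Om x -> u x0 - phi x0 <= u x - phi x) ->
    0 <= F x0 (u x0) (Dphi x0) \/ (boundary Om x0 /\ g x0 <= u x0).

Definition dirichlet_solution (R : realType) (n : nat) (Om : set 'rV[R]_n)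
    (F : 'rV[R]_n -> R -> 'rV[R]_n -> R) (g u : 'rV[R]_n -> R) : Prop :=
  [/\ {within closure Om, continuous u},
      dirichlet_sub Om F g u & dirichlet_super Om F g u].

Definition comparison_principle (R : realType) (n : nat) (Om : set 'rV[R]_n)
    (F : 'rV[R]_n -> R -> 'rV[R]_n -> R) (g : 'rV[R]_n -> R) : Prop :=
  forall u v : 'rV[R]_n -> R,
    {within closure Om, continuous u} -> {within closure Om, continuous v} ->
    dirichlet_sub Om F g u -> dirichlet_super Om F g v ->
    forall x, closure Om x -> u x <= v x.

(* The i-th equation of the system, uj being the other unknown. *)
Definition system_eq (R : realType) (n : nat) (H : 'rV[R]_n -> 'rV[R]_n -> R)
    (eps : R) (uj : 'rV[R]_n -> R) (x : 'rV[R]_n) (s : R) (p : 'rV[R]_n) : R :=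
  s + H (eps^-1 *: x) p + eps^-1 * (s - uj x).

Definition system_solution (R : realType) (n : nat) (Om : set 'rV[R]_n)
    (H1 H2 : 'rV[R]_n -> 'rV[R]_n -> R) (g1 g2 : 'rV[R]_n -> R) (eps : R)
    (u1 u2 : 'rV[R]_n -> R) : Prop :=
  dirichlet_solution Om (system_eq H1 eps u2) g1 u1 /\
  dirichlet_solution Om (system_eq H2 eps u1) g2 u2.

Definition limit_eq (R : realType) (n : nat) (Hbar : 'rV[R]_n -> R)
    (x : 'rV[R]_n) (s : R) (p : 'rV[R]_n) : R := s + Hbar p.

Definition C1 (R : realType) (n : nat) (phi : 'rV[R]_n -> R) : Prop :=
  (forall x, differentiable phi x) /\ continuous (grad phi).

Definition viscosity_solution (R : realType) (n : nat)
    (F : 'rV[R]_n -> R -> 'rV[R]_n -> R) (v : 'rV[R]_n -> R) : Prop :=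
  forall phi xi0, C1 phi ->
    ((\forall xi \near xi0, v xi - phi xi <= v xi0 - phi xi0) ->
       F xi0 (v xi0) (grad phi xi0) <= 0) /\
    ((\forall xi \near xi0, v xi0 - phi xi0 <= v xi - phi xi) ->
       0 <= F xi0 (v xi0) (grad phi xi0)).

Definition cell_eq (R : realType) (n : nat) (H : 'rV[R]_n -> 'rV[R]_n -> R)
    (P : 'rV[R]_n) (c : R) (vj : 'rV[R]_n -> R)
    (xi : 'rV[R]_n) (s : R) (p : 'rV[R]_n) : R :=
  H xi (P + p) + s - vj xi - c.

Definition cell_solvable (R : realType) (n : nat)
    (H1 H2 : 'rV[R]_n -> 'rV[R]_n -> R) (P : 'rV[R]_n) (c : R) : Prop :=
  exists v1 v2 : 'rV[R]_n -> R,
    [/\ continuous v1 /\ continuous v2, Zperiodic v1 /\ Zperiodic v2,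
        viscosity_solution (cell_eq H1 P c v2) v1 &
        viscosity_solution (cell_eq H2 P c v1) v2].

Definition effective_hamiltonian (R : realType) (n : nat)
    (H1 H2 : 'rV[R]_n -> 'rV[R]_n -> R) (Hbar : 'rV[R]_n -> R) : Prop :=
  forall P, unique (cell_solvable H1 H2 P) (Hbar P).

Definition cvg_locally_uniformly (R : realType) (n : nat)
    (Om : set 'rV[R]_n) (w : R -> 'rV[R]_n -> R) (u : 'rV[R]_n -> R) : Prop :=
  forall K, compact K -> K `<=` Om -> {uniform K, w eps @[eps --> 0^'+] --> u}.

(* Main.v *)
Require Import Defs.
From mathcomp Require Import all_boot all_order all_algebra.
From mathcomp Require Import all_classical all_reals all_analysis.
From mathcomp Require Import ring lra.

Set Implicit Arguments.
Unset Strict Implicit.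
Unset Printing Implicit Defensive.

Import Order.TTheory GRing.Theory Num.Theory.
Import numFieldNormedType.Exports.

Local Open Scope classical_set_scope.
Local Open Scope ring_scope.

(* A subsolution touched from above by a smooth function gives
   [(u_b - u_{~~b}) / eps <= C], since the Hamiltonians are bounded below. Hence
   the coupling terms stay bounded and coercivity bounds all touching slopes
   independently of [eps]; as the boundary is Lipschitz, the family is
   equicontinuous up to the boundary. The upper and lower limits as [eps -> 0]
   are therefore continuous, so that comparison between continuous functions is
   enough to identify them.

   That the lower limit is a supersolution follows from the perturbed test
   function method, with the variable of the corrector doubled; this variable
   ranges over the whole space, so boundary points need no special care. The
   upper limit is treated through the reflection [u -> - u],
   [H(xi, p) -> - H(xi, - p)] at interior points only: at the boundary,
   coercivity forces [u_b <= g_b] pointwise, for both [b], hence the boundary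
   datum [min g_1 g_2]. *)

(** * Continuity and compactness *)

(** Correctors are merely continuous, so [phi + eps * v (x / eps)] is not an admissible test
    function; doubling puts a smooth quadratic between the two. The same momentum [q] then enters
    the equation for [u] and the cell equation. To compare them, one of the two momenta must be
    bounded: coercivity provides this through the inequality of the right sign, the cell one for
    [H], the one for [u] after reflection.

    The boundary alternative of the supersolution argument concerns the component [b] selected by
    the minimum, so [g b <= m] for some [b], which is [min g_1 g_2 <= m]. Reflected, the same
    argument would give [u <= g b] for some [b], hence only the datum [max g_1 g_2]; this is why the
    boundary inequality for subsolutions has its own barrier argument, valid for each [b].

    The gap between the components is [O(eps)], so the limits are built from [u true] alone. *)

Definition cont_on (R : realType) (V W : normedModType R) (K : set V)
    (f : V -> W) : Prop :=
  forall x, K x -> forall eta : R, 0 < eta ->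
    exists2 delta : R, 0 < delta &
      forall y, K y -> `|y - x| < delta -> `|f y - f x| < eta.

Lemma near_norm_ballP (R : realType) (V : normedModType R) (x : V) (P : set V) :
  nbhs x P <->
  exists2 d : R, 0 < d & forall y, `|y - x| < d -> P y.
Proof.
split=> [/nbhs_ballP[d /= d0 H]|[d d0 H]]; last apply/nbhs_ballP;
  exists d => // y yx; apply: H.
  by rewrite -ball_normE /= distrC.
by move: yx; rewrite -ball_normE /= distrC.
Qed.

Lemma within_continuousE (R : realType) (V W : normedModType R) (K : set V)
    (f : V -> W) : {within K, continuous f} <-> cont_on K f.
Proof.
rewrite subspace_continuousP; split=> H x Kx.
  move=> eta eta0; have /cvgrPdist_lt/(_ _ eta0) := H x Kx.
  rewrite near_withinE => /near_norm_ballP[d d0 dP]; exists d => // y Ky yx.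
  by rewrite distrC; exact: dP.
apply/cvgrPdist_lt => eta eta0; rewrite near_withinE; apply/near_norm_ballP.
have [d d0 dP] := H x Kx eta eta0; exists d => // y yx Ky.
by rewrite distrC; exact: dP.
Qed.

Lemma continuousE (R : realType) (V W : normedModType R) (f : V -> W) :
  continuous f <-> cont_on setT f.
Proof.
split=> H x.
  move=> _ eta eta0; have /cvgrPdist_lt/(_ _ eta0) := H x.
  move/near_norm_ballP => -[d d0 dP]; exists d => // y _ yx.
  by rewrite distrC; exact: dP.
apply/cvgrPdist_lt => eta eta0; apply/near_norm_ballP.
have [d d0 dP] := H x I eta eta0; exists d => // y yx.
by rewrite distrC; exact: dP.
Qed.

Lemma cont_onS (R : realType) (V W : normedModType R) (K L : set V)
    (f : V -> W) : K `<=` L -> cont_on L f -> cont_on K f.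
Proof.
move=> KL H x /KL Lx eta eta0; have [d d0 dP] := H x Lx eta eta0.
by exists d => // y /KL; exact: dP.
Qed.

Lemma cont_onD (R : realType) (V W : normedModType R) (K : set V)
    (f g : V -> W) :
  cont_on K f -> cont_on K g -> cont_on K (fun x => f x + g x).
Proof.
move=> /within_continuousE/subspace_continuousP Hf.
move=> /within_continuousE/subspace_continuousP Hg.
apply/within_continuousE/subspace_continuousP => x Kx.
by apply: cvgD; [exact: Hf|exact: Hg].
Qed.

Lemma cont_onN (R : realType) (V W : normedModType R) (K : set V)
    (f : V -> W) : cont_on K f -> cont_on K (fun x => - f x).
Proof.
move=> H x Kx eta eta0; have [d d0 dP] := H x Kx eta eta0.
by exists d => // y Ky yx; rewrite -opprD normrN; exact: dP.
Qed.

Lemma cont_on_norm (R : realType) (V W : normedModType R) (K : set V)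
    (f : V -> W) : cont_on K f -> cont_on K (fun x => `|f x|).
Proof.
move=> H x Kx eta eta0; have [d d0 dP] := H x Kx eta eta0.
exists d => // y Ky yx; apply: le_lt_trans (dP y Ky yx).
exact: ler_dist_dist.
Qed.

(** Compactness in near-covering form, with the filter of small positive [e]. The scale [e] is
    successively a modulus of continuity, the radius of a tube around a chord, and the
    homogenization scale. *)
Lemma compact_uniform_scale (R : realType) (V : normedModType R) (K : set V)
    (P : R -> V -> Prop) :
  compact K ->
  (forall x, K x -> exists2 d : R, 0 < d &
     forall y (e : R), K y -> `|y - x| < d -> 0 < e -> e < d -> P e y) ->
  exists2 d : R, 0 < d & forall y (e : R), K y -> 0 < e -> e < d -> P e y.
Proof.
move=> /compact_near_coveringP/near_covering_withinP cK H.
have [|d d0 dP] := @cK R (0^'+ : set_system R) P _ _; last first.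
  exists d => // y e Ky e0 ed; apply: (dP e) => //=.
  by rewrite sub0r normrN gtr0_norm.
move=> x /H[d d0 dP].
exists ([set y | `|y - x| < d], [set e | 0 < e /\ e < d]) => /=; last first.
  by case=> y e /= [yx [e0 ed]] Ky; exact: dP.
split; first by apply/near_norm_ballP; exists d.
exists d => //= e /= ed e0. split=> //.
by move: ed; rewrite add0r normrN gtr0_norm.
Qed.

Lemma compact_max (R : realType) (V : normedModType R) (K : set V)
    (f : V -> R) :
  K !=set0 -> compact K -> cont_on K f ->
  exists2 c, K c & forall x, K x -> f x <= f c.
Proof.
move=> K0 cK /within_continuousE cf.
have [c /set_mem Kc cP] := compact_EVT_max K0 cK cf.
by exists c => // x Kx; apply: cP; exact: mem_set.
Qed.

Lemma compact_min (R : realType) (V : normedModType R) (K : set V)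
    (f : V -> R) :
  K !=set0 -> compact K -> cont_on K f ->
  exists2 c, K c & forall x, K x -> f c <= f x.
Proof.
move=> K0 cK /cont_onN cf; have [c Kc cP] := compact_max K0 cK cf.
by exists c => // x Kx; rewrite -lerN2 cP.
Qed.

(** * Quadratic test functions *)

Section Quadratic.
Variables (R : realType) (n : nat).
Implicit Types x y z : 'rV[R]_n.

Lemma coord_le x i : `|x 0 i| <= `|x|.
Proof.
rewrite [leRHS]/Num.Def.normr /= mx_normrE.
by apply/bigmax_geP; right; exists (ord0, i).
Qed.

Lemma rV_norm_le x (c : R) : 0 <= c -> (forall i, `|x 0 i| <= c) -> `|x| <= c.
Proof.
move=> c0 H; rewrite [leLHS]/Num.Def.normr /= mx_normrE.
by apply/bigmax_leP; split=> // -[i j] _ /=; rewrite ord1.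
Qed.

Lemma dotvC x y : dotv x y = dotv y x.
Proof. by apply: eq_bigr => i _; rewrite mulrC. Qed.

Lemma dotvDl x y z : dotv (x + y) z = dotv x z + dotv y z.
Proof. by rewrite -big_split; apply: eq_bigr => i _; rewrite mxE mulrDl. Qed.

Lemma dotvZl a x y : dotv (a *: x) y = a * dotv x y.
Proof.
by rewrite /dotv big_distrr /=; apply: eq_bigr => i _; rewrite mxE mulrA.
Qed.

Lemma dotvNl x y : dotv (- x) y = - dotv x y.
Proof. by rewrite -scaleN1r dotvZl mulN1r. Qed.

Lemma dotvDr x y z : dotv x (y + z) = dotv x y + dotv x z.
Proof. by rewrite !(dotvC x) dotvDl. Qed.

Lemma dotvZr a x y : dotv x (a *: y) = a * dotv x y.
Proof. by rewrite !(dotvC x) dotvZl. Qed.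

Lemma dotv_le x y : `|dotv x y| <= n%:R * (`|x| * `|y|).
Proof.
apply: (le_trans (ler_norm_sum _ _ _)).
rewrite -[n in n%:R]card_ord mulr_natl -sumr_const.
by apply: ler_sum => i _; rewrite normrM ler_pM// coord_le.
Qed.

Lemma dotv00 : dotv (0 : 'rV[R]_n) 0 = 0.
Proof. by rewrite /dotv big1// => i _; rewrite !mxE mul0r. Qed.

Lemma dotv_ge0 x : 0 <= dotv x x.
Proof. by apply: sumr_ge0 => i _; rewrite -expr2 sqr_ge0. Qed.

(** Distances are measured in the sup norm, whereas penalizations must be smooth and use [dotv].
    This inequality and [dotv_le] are the bridge, the latter at the price of a factor [n]. *)
Lemma norm_sqr_le_dotv x : `|x| ^+ 2 <= dotv x x.
Proof.
rewrite -[leRHS]sqr_sqrtr ?dotv_ge0// lerXn2r ?nnegrE ?sqrtr_ge0//.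
apply: rV_norm_le; first exact: sqrtr_ge0.
move=> i; rewrite -sqrtr_sqr ler_wsqrtr// /dotv (bigD1 i)//= -expr2 lerDl.
by apply: sumr_ge0 => j _; rewrite -expr2 sqr_ge0.
Qed.

Lemma norm_le_enorm x : `|x| <= enorm x.
Proof.
rewrite -[leLHS]normr_id -sqrtr_sqr ler_wsqrtr//; exact: norm_sqr_le_dotv.
Qed.

Lemma dotv_delta x (i : 'I_n) : dotv x (delta_mx 0 i) = x 0 i.
Proof.
rewrite /dotv (bigD1 i)//= mxE !eqxx mulr1 big1 ?addr0// => j ji.
by rewrite mxE (negbTE ji) andbF mulr0.
Qed.

Lemma grad_quad a z x :
  grad (fun y => a * dotv (y - z) (y - z)) x = (a *+ 2) *: (x - z).
Proof.
apply/rowP => i; rewrite /grad [LHS]mxE [RHS]mxE -dotv_delta.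
set v := delta_mx 0 i; apply/cvg_lim => //.
set c := a *+ 2 * _.
apply: (@cvg_trans _ ((c + h * (a * dotv v v)) @[h --> (0 : R)^'])).
  apply: near_eq_cvg; near=> h.
  have h0 : h != 0 by near: h; exact: nbhs_dnbhs_neq.
  rewrite /= -addrA; set w := x - z in c *.
  rewrite (dotvDl _ w) !(dotvDr _ _ w) !dotvZl !dotvZr (dotvC v w).
  rewrite /c -mulr_natr /GRing.scale /=; field.
  exact: h0.
suff H : (c + h * (a * dotv v v)) @[h --> (0 : R)^'] --> c + 0 * (a * dotv v v).
  by move: H; rewrite mul0r addr0.
apply: cvgD; first exact: cvg_cst.
by apply: cvgM; [exact: cvg_within|exact: cvg_cst].
Unshelve. all: end_near. Qed.

Lemma differentiable_quad a z x :
  differentiable (fun y => a * dotv (y - z) (y - z)) x.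
Proof.
have -> : (fun y => a * dotv (y - z) (y - z)) =
    \sum_(i < n) (fun y : 'rV[R]_n => a * ((y 0 i - z 0 i) * (y 0 i - z 0 i))).
  apply/funext => y; rewrite fct_sumE big_distrr.
  by apply: eq_bigr => i _; rewrite !mxE.
apply: differentiable_sum => i.
have dd : differentiable (fun y : 'rV[R]_n => y 0 i - z 0 i : R) x.
  by apply: differentiableB => //; exact: differentiable_coord.
apply: (@differentiableM _ _ (fun=> a)); first exact: differentiable_cst.
exact: differentiableM.
Qed.

End Quadratic.

(** * Stability of test functions under quadratics and sign change *)

Section TestFunctions.
Variables (R : realType) (n : nat).
Implicit Types (x y z : 'rV[R]_n) (phi psi : 'rV[R]_n -> R).

Lemma gradD phi psi x : differentiable phi x -> differentiable psi x ->
  grad (fun y => phi y + psi y) x = grad phi x + grad psi x.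
Proof.
move=> dphi dpsi; apply/rowP => i; rewrite !mxE.
by apply: deriveD; exact: diff_derivable.
Qed.

Lemma gradN phi x : differentiable phi x ->
  grad (fun y => - phi y) x = - grad phi x.
Proof.
move=> dphi; apply/rowP => i; rewrite !mxE.
by apply: deriveN; exact: diff_derivable.
Qed.

Lemma cont_quad (K : set 'rV[R]_n) a z :
  cont_on K (fun y => a * dotv (y - z) (y - z)).
Proof.
apply: (@cont_onS _ _ _ _ setT) => //; apply/continuousE => x.
exact/differentiable_continuous/differentiable_quad.
Qed.

Lemma cont_affine (K : set 'rV[R]_n) a z : cont_on K (fun y => a *: (y - z)).
Proof.
move=> x _ eta eta0; exists (eta / (`|a| + 1)).
  by rewrite divr_gt0// ltr_wpDl.
move=> y _; rewrite ltr_pdivlMr ?ltr_wpDl// => yx.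
rewrite -scalerBr opprB addrA subrK normrZ mulrC.
by apply: le_lt_trans yx; rewrite ler_wpM2l// lerDl.
Qed.

Lemma C1_closure0 (Om : set 'rV[R]_n) : C1_closure Om (fun=> 0) (fun=> 0).
Proof.
split; [exact: cst_continuous|exact: cst_continuous|move=> x _].
split; first exact: differentiable_cst.
by apply/rowP => i; rewrite !mxE derive_cst.
Qed.

Lemma C1_closure_quad (Om : set 'rV[R]_n) phi Dphi a z :
  C1_closure Om phi Dphi ->
  C1_closure Om (fun x => phi x + a * dotv (x - z) (x - z))
    (fun x => Dphi x + (a *+ 2) *: (x - z)).
Proof.
case=> /within_continuousE c1 /within_continuousE c2 dphi; split.
- by apply/within_continuousE/cont_onD => //; exact: cont_quad.
- by apply/within_continuousE/cont_onD => //; exact: cont_affine.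
move=> x /dphi[d1 d2]; have d3 := differentiable_quad a z x.
by split; [exact: differentiableD|rewrite gradD// grad_quad d2].
Qed.

Lemma C1_closureN (Om : set 'rV[R]_n) phi Dphi :
  C1_closure Om phi Dphi ->
  C1_closure Om (fun x => - phi x) (fun x => - Dphi x).
Proof.
case=> /within_continuousE c1 /within_continuousE c2 dphi; split.
- exact/within_continuousE/cont_onN.
- exact/within_continuousE/cont_onN.
by move=> x /dphi[d1 d2]; split; [exact: differentiableN|rewrite gradN// d2].
Qed.

Lemma C1_quad a z : C1 (fun y => a * dotv (y - z) (y - z)).
Proof.
split; first by move=> x; exact: differentiable_quad.
have -> : grad (fun y => a * dotv (y - z) (y - z)) =
    (fun y => (a *+ 2) *: (y - z)) by apply/funext => y; rewrite grad_quad.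
exact/continuousE/cont_affine.
Qed.

Lemma C1N phi : C1 phi -> C1 (fun x => - phi x).
Proof.
case=> d c; split; first by move=> x; exact/differentiableN/d.
have -> : grad (fun x => - phi x) = (fun x => - grad phi x).
  by apply/funext => x; rewrite gradN//; exact: d.
by apply/continuousE/cont_onN/continuousE.
Qed.

End TestFunctions.

(** * Reflection *)

Section Reflection.
Variables (R : realType) (n : nat).
Implicit Types (F : 'rV[R]_n -> R -> 'rV[R]_n -> R) (u g : 'rV[R]_n -> R).

Definition reflect_eq F x s p : R := - F x (- s) (- p).

Definition reflect_ham (H : 'rV[R]_n -> 'rV[R]_n -> R) xi p : R := - H xi (- p).

Lemma dirichlet_super_reflect (Om : set 'rV[R]_n) F g u :
  dirichlet_sub Om F g u ->
  dirichlet_super Om (reflect_eq F) (fun x => - g x) (fun x => - u x).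
Proof.
move=> H phi Dphi x0 cphi Kx0 m; rewrite /reflect_eq opprK oppr_ge0 lerN2.
apply: (H (fun x => - phi x) (fun x => - Dphi x)) => //.
  exact: C1_closureN.
by move=> x Kx; have := m x Kx; lra.
Qed.

Lemma dirichlet_sub_reflect (Om : set 'rV[R]_n) F g u :
  dirichlet_super Om (reflect_eq F) (fun x => - g x) (fun x => - u x) ->
  dirichlet_sub Om F g u.
Proof.
move=> H phi Dphi x0 cphi Kx0 m.
have := H (fun x => - phi x) (fun x => - Dphi x) x0 (C1_closureN cphi) Kx0.
rewrite /reflect_eq !opprK oppr_ge0 lerN2; apply.
by move=> x Kx; have := m x Kx; lra.
Qed.

Lemma viscosity_solution_reflect F u :
  viscosity_solution F u ->
  viscosity_solution (reflect_eq F) (fun x => - u x).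
Proof.
move=> H phi x0 cphi; have [H1 H2] := H _ x0 (C1N cphi).
have E : grad (fun x => - phi x) x0 = - grad phi x0.
  by rewrite gradN//; exact: (cphi.1 x0).
rewrite E in H1 H2; rewrite /reflect_eq opprK oppr_ge0 oppr_le0; split=> m.
  by apply: H2; apply: filterS m => x; lra.
by apply: H1; apply: filterS m => x; lra.
Qed.

Lemma system_eq_reflect H eps uj :
  reflect_eq (system_eq H eps uj) =
  system_eq (reflect_ham H) eps (fun x => - uj x).
Proof.
apply/funext => x; apply/funext => s; apply/funext => p.
by rewrite /reflect_eq /system_eq /reflect_ham; ring.
Qed.

Lemma limit_eq_reflect Hbar :
  reflect_eq (limit_eq Hbar) = limit_eq (fun p : 'rV[R]_n => - Hbar (- p)).
Proof.
apply/funext => x; apply/funext => s; apply/funext => p.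
by rewrite /reflect_eq /limit_eq; ring.
Qed.

(** Reflected correctors belong to the momentum [- P] and the constant [- c], so the effective
    Hamiltonian becomes [- Hbar (- p)]. *)
Lemma cell_eq_reflect H P c vj :
  reflect_eq (cell_eq H P c vj) =
  cell_eq (reflect_ham H) (- P) (- c) (fun x => - vj x).
Proof.
apply/funext => x; apply/funext => s; apply/funext => p.
rewrite /reflect_eq /cell_eq /reflect_ham.
have -> : - (- P + p) = P - p by rewrite opprD opprK.
by ring.
Qed.

End Reflection.

(** * Hamiltonians *)

Section Hamiltonians.
Variables (R : realType) (n : nat).

Lemma compact_norm_le (r : R) : compact [set x : 'rV[R]_n | `|x| <= r].
Proof.
apply: bounded_closed_compact.
  exists r; split; first exact: num_real.
  by move=> M rM x /= xr; apply: (le_trans xr); exact: ltW.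
apply: (@closed_comp _ _ (fun x : 'rV[R]_n => `|x|) [set t | t <= r]).
  by move=> x _; exact: norm_continuous.
exact: closed_le.
Qed.

(** Subtracting integer parts. With periodicity, this replaces the whole space of [xi] by a compact
    ball. *)
Lemma integer_shift (xi : 'rV[R]_n) :
  exists z : 'rV[int]_n, `|xi + map_mx intr z| <= 1.
Proof.
exists (\row_i - Num.floor (xi 0 i)); apply: rV_norm_le => // i.
rewrite !mxE rmorphN /=.
have := floor_le (xi 0 i); have := floorD1_gt (xi 0 i).
by rewrite intrD => h1 h2; rewrite ger0_norm; lra.
Qed.

Lemma Zperiodic_bounded (v : 'rV[R]_n -> R) : continuous v -> Zperiodic v ->
  exists2 C, 0 <= C & forall xi, `|v xi| <= C.
Proof.
move=> cv pv; pose K := [set x : 'rV[R]_n | `|x| <= 1].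
have [|||c Kc cP] := @compact_max R _ K (fun x => `|v x|).
- by exists 0; rewrite /K/= normr0.
- exact: compact_norm_le.
- apply/cont_on_norm/(@cont_onS _ _ _ _ setT) => //; exact/continuousE.
exists `|v c| => // xi; have [z zP] := integer_shift xi.
by rewrite -(pv xi z); exact: cP.
Qed.

Variable H : 'rV[R]_n -> 'rV[R]_n -> R.
Hypothesis hH : hamiltonian H.

Lemma hamiltonian_coercive (M : R) :
  exists2 Q, 0 < Q & forall xi p, H xi p <= M -> `|p| <= Q.
Proof.
have [_ cH _] := hH.
have [A [_ AP]] := cvgey_ge cH (M + 1).
exists (`|A| + 1); first by rewrite ltr_wpDl.
move=> xi p HM; rewrite leNgt; apply/negP => pA.
have AP1 : A < `|A| + 1 by rewrite ltr_pwDr// ler_norm.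
suff : M + 1 <= H xi p by lra.
rewrite -lee_fin; apply: (le_trans (AP _ AP1)).
apply: ereal_inf_lbound; exists xi, p; split=> //.
by apply: (le_trans (ltW pA)); exact: norm_le_enorm.
Qed.

Let cube (Q : R) :=
  [set x : 'rV[R]_n | `|x| <= 1] `*` [set x : 'rV[R]_n | `|x| <= Q].

Let cube_compact Q : compact (cube Q).
Proof. exact: (compact_setX (@compact_norm_le 1) (@compact_norm_le Q)). Qed.

Let Hcont : cont_on setT (fun q : 'rV[R]_n * 'rV[R]_n => H q.1 q.2).
Proof. by case: hH => /continuousE. Qed.

Lemma hamiltonian_bounded (Q : R) :
  exists2 C, 0 <= C & forall xi p, `|p| <= Q -> `|H xi p| <= C.
Proof.
have [Q0|Q0] := leP 0 Q; last first.
  exists 0 => // xi p pQ; have := normr_ge0 p; lra.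
have [|||c Kc cP] := @compact_max R _ (cube Q) (fun q => `|H q.1 q.2|).
- by exists (0, 0); rewrite /cube/= !normr0.
- exact: cube_compact.
- exact/cont_on_norm/(@cont_onS _ _ _ _ setT).
exists `|H c.1 c.2| => // xi p pQ; have [z zP] := integer_shift xi.
have [_ _ pH] := hH.
by rewrite -(pH xi z); exact: (cP (_, _)).
Qed.

(** Where [H] is nonpositive, coercivity confines [p] to a ball, on which [H] is bounded. *)
Lemma hamiltonian_bounded_below :
  exists2 C, 0 <= C & forall xi p, - C <= H xi p.
Proof.
have [Q Q0 QP] := hamiltonian_coercive 0.
have [C C0 CP] := hamiltonian_bounded Q.
exists C => // xi p; have [h|h] := leP (H xi p) 0; last lra.
by have := CP xi p (QP _ _ h); rewrite ler_norml => /andP[].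
Qed.

(** Only [p] is confined to the ball, [p'] may leave it; hence [P] quantifies over all [xi'], [p']
    near a point of the compact cube. One integer shift is applied to both [xi] and [xi'], which
    preserves their difference. *)
Lemma hamiltonian_uniform (Q eta : R) : 0 < eta ->
  exists2 d, 0 < d & forall xi xi' p p', `|p| <= Q ->
    `|xi' - xi| < d -> `|p' - p| < d -> `|H xi' p' - H xi p| < eta.
Proof.
move=> eta0.
pose P (e : R) (q : 'rV[R]_n * 'rV[R]_n) := forall xi' p',
  `|xi' - q.1| < e -> `|p' - q.2| < e -> `|H xi' p' - H q.1 q.2| < eta.
have [|d d0 dP] := @compact_uniform_scale R _ _ P (@cube_compact Q).
  move=> q _; have [|d d0 dP] := @Hcont q I (eta / 2); first lra.
  have d2 : 0 < d / 2 by lra.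
  exists (d / 2) => // q' e _ qq e0 ed xi' p' xx pp.
  have qq1 : `|q'.1 - q.1| < d / 2.
    by apply: le_lt_trans qq; rewrite prod_normE le_max lexx.
  have qq2 : `|q'.2 - q.2| < d / 2.
    by apply: le_lt_trans qq; rewrite prod_normE le_max lexx orbT.
  have h1 : `|H q'.1 q'.2 - H q.1 q.2| < eta / 2 by apply: dP => //; lra.
  have h2 : `|H xi' p' - H q.1 q.2| < eta / 2.
    apply: (dP (xi', p')) => //; rewrite prod_normE gt_max /=.
    have t1 := ler_distD q'.1 xi' q.1; have t2 := ler_distD q'.2 p' q.2.
    by apply/andP; split; lra.
  rewrite (distrC _ (H q.1 q.2)) in h1.
  have := ler_distD (H q.1 q.2) (H xi' p') (H q'.1 q'.2); lra.
have d2 : 0 < d / 2 by lra.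
exists (d / 2) => // xi xi' p p' pQ xx pp.
have [z zP] := integer_shift xi; have [_ _ pH] := hH.
rewrite -(pH xi z) -(pH xi' z).
apply: (dP (xi + map_mx intr z, p) (d / 2)) => //=.
  by lra.
by rewrite opprD addrACA subrr addr0.
Qed.

End Hamiltonians.

(** * Estimates uniform in the scale *)

Section AprioriEstimates.
Variables (R : realType) (n : nat) (Om : set 'rV[R]_n).
Implicit Types (x y z : 'rV[R]_n) (u w g : 'rV[R]_n -> R).

Lemma closure_normE x (r : R) : closure Om x -> 0 < r ->
  exists2 y, Om y & `|y - x| < r.
Proof.
move=> clx r0; have [|y [Oy yP]] := clx [set y | `|y - x| < r]; last by exists y.
by apply/near_norm_ballP; exists r.
Qed.

Lemma open_normE x : open Om -> Om x ->
  exists2 r : R, 0 < r & forall y, `|y - x| < r -> Om y.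
Proof.
by move=> oOm Ox; have /near_norm_ballP : nbhs x Om by exact: open_nbhs_nbhs.
Qed.

Lemma compact_closure_bounded : bounded_set Om -> compact (closure Om).
Proof.
move=> [M [_ MP]].
apply: (subclosed_compact (@closed_closure _ _) (@compact_norm_le R n (M + 2))).
move=> x clx /=; have [y Oy yx] := closure_normE clx ltr01.
have yM : `|y| <= M + 1 by apply: MP => //; rewrite ltrDl.
have := ler_distD y x 0; rewrite !subr0 (distrC x y); lra.
Qed.

Lemma closure_le (f : 'rV[R]_n -> R) c : cont_on (closure Om) f ->
  (forall x, Om x -> f x <= c) -> forall x, closure Om x -> f x <= c.
Proof.
move=> cf Of x clx; rewrite leNgt; apply/negP => cx.
have [|d d0 dP] := cf x clx (f x - c); first lra.
have [y Oy yx] := closure_normE clx d0.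
have := dP y (subset_closure Oy) yx; rewrite ltr_norml => /andP[h _].
have := Of y Oy; lra.
Qed.

Hypothesis cK : compact (closure Om).

(** At the smaller of the two minima the coupling term is nonpositive, and a constant test function
    gives [0 <= u b c + H b _ 0]. As the tested slope is zero, reflected Hamiltonians are covered
    too, whence the upper bound. *)
Lemma super_lower_bound (H : bool -> 'rV[R]_n -> 'rV[R]_n -> R)
    (g u : bool -> 'rV[R]_n -> R) (eps C : R) :
  0 < eps ->
  (forall b, cont_on (closure Om) (u b)) ->
  (forall b, dirichlet_super Om (system_eq (H b) eps (u (~~ b))) (g b) (u b)) ->
  (forall b xi, H b xi 0 <= C) ->
  (forall b x, boundary Om x -> - C <= g b x) ->
  forall b x, closure Om x -> - C <= u b x.
Proof.
move=> e0 cu su HC gC.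
suff key b c c' : closure Om c -> (forall x, closure Om x -> u b c <= u b x) ->
    (forall x, closure Om x -> u (~~ b) c' <= u (~~ b) x) ->
    u b c <= u (~~ b) c' -> - C <= u b c.
  move=> b x Kx.
  have K0 : closure Om !=set0 by exists x.
  have [c Kc cP] := compact_min K0 cK (cu b).
  have [c' Kc' cP'] := compact_min K0 cK (cu (~~ b)).
  have h := cP x Kx.
  have [le|lt] := leP (u b c) (u (~~ b) c').
    by have := key b c c' Kc cP cP' le; lra.
  have := key (~~ b) c' c Kc' cP'; rewrite negbK => /(_ cP (ltW lt)); lra.
move=> Kc cP cP' le.
have [||] := su b (fun=> 0) (fun=> 0) c (C1_closure0 Om) Kc.
- by move=> x Kx; have := cP x Kx; lra.
- rewrite /system_eq => h.
  have : eps^-1 * (u b c - u (~~ b) c) <= 0.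
    rewrite pmulr_rle0 ?invr_gt0// subr_le0; exact: le_trans le (cP' _ Kc).
  have := HC b (eps^-1 *: c); lra.
- by case=> bc; have := gC b c bc; lra.
Qed.

Lemma quad_max u a z : closure Om !=set0 -> cont_on (closure Om) u ->
  exists2 x, closure Om x & forall x', closure Om x' ->
    u x' - a * dotv (x' - z) (x' - z) <= u x - a * dotv (x - z) (x - z).
Proof.
move=> K0 cu; apply: compact_max => //; apply: cont_onD => //.
exact/cont_onN/cont_quad.
Qed.

Lemma dirichlet_sub_quad F g u a z x : dirichlet_sub Om F g u ->
  closure Om x ->
  (forall x', closure Om x' ->
    u x' - a * dotv (x' - z) (x' - z) <= u x - a * dotv (x - z) (x - z)) ->
  F x (u x) ((a *+ 2) *: (x - z)) <= 0 \/ (boundary Om x /\ u x <= g x).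
Proof.
move=> su Kx xmax; have := su _ _ x (C1_closure_quad a z (C1_closure0 Om)) Kx.
by rewrite !add0r; apply=> x' Kx'; rewrite !add0r; exact: xmax.
Qed.

(** Comparing [x] with the centre [z] gives [a * dotv (x - z) (x - z) <= u x - u z <= 2 * C], so a
    steep quadratic localizes its maximizer. *)
Lemma quad_max_near u a z x (C d : R) : 0 < d -> 0 <= C ->
  (forall x, closure Om x -> `|u x| <= C) -> 2 * C < a * d ^+ 2 ->
  closure Om z -> closure Om x ->
  (forall x', closure Om x' ->
    u x' - a * dotv (x' - z) (x' - z) <= u x - a * dotv (x - z) (x - z)) ->
  `|x - z| < d /\ u z <= u x - a * dotv (x - z) (x - z).
Proof.
move=> d0 C0 uC Cad Kz Kx /(_ z Kz).
rewrite subrr dotv00 mulr0 subr0 => uzx; split=> //.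
rewrite ltNge; apply/negP => dxz.
have a0 : 0 < a.
  by rewrite -(pmulr_lgt0 _ (exprn_gt0 2 d0)); apply: le_lt_trans Cad; lra.
have : a * d ^+ 2 <= a * dotv (x - z) (x - z).
  rewrite ler_pM2l//; apply: le_trans (norm_sqr_le_dotv _).
  by rewrite lerXn2r ?nnegrE// ltW.
have /ler_normlP[_ h1] := uC x Kx; have /ler_normlP[h2 _] := uC z Kz; lra.
Qed.

Hypothesis oOm : open Om.

Lemma interior_not_boundary x : Om x -> ~ boundary Om x.
Proof. by move=> Ox []. Qed.

(** Steep quadratics touch [u] from above arbitrarily close to any interior point. The slope there
    is uncontrolled, but [H >= - C] and [u >= - C] give [eps^-1 * (u - w) <= 2 * C], and continuity
    transfers this to every point. *)
Lemma sub_gap H eps g u w (C : R) : 0 < eps -> 0 <= C ->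
  cont_on (closure Om) u -> cont_on (closure Om) w ->
  dirichlet_sub Om (system_eq H eps w) g u ->
  (forall x, closure Om x -> `|u x| <= C) -> (forall xi p, - C <= H xi p) ->
  forall x, closure Om x -> u x - w x <= (2 * C) * eps.
Proof.
move=> e0 C0 cu cw su uC HC; apply: closure_le.
  by apply: cont_onD => //; exact: cont_onN.
move=> z Oz; rewrite leNgt; apply/negP => gap.
have cuw : cont_on (closure Om) (fun x => u x - w x).
  by apply: cont_onD => //; exact: cont_onN.
have Kz := subset_closure Oz.
have [|d d0 dP] := cuw z Kz (u z - w z - (2 * C) * eps); first lra.
have [r r0 rP] := open_normE oOm Oz.
pose s := Num.min d r; have s0 : 0 < s by rewrite lt_min d0.
have K0 : closure Om !=set0 by exists z.
have [x Kx xmax] := quad_max ((2 * C + 1) / s ^+ 2) z K0 cu.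
have [] := quad_max_near s0 C0 uC _ Kz Kx xmax.
  by rewrite divfK ?gt_eqF ?exprn_gt0//; lra.
rewrite lt_min => /andP[xd xr] _.
have [|] := dirichlet_sub_quad su Kx xmax; last first.
  by move=> [/(interior_not_boundary (rP _ xr))].
rewrite /system_eq => h.
have h2 := HC (eps^-1 *: x) ((((2 * C + 1) / s ^+ 2) *+ 2) *: (x - z)).
have /ler_normlP[h3 _] := uC x Kx.
have : eps^-1 * (u x - w x) <= 2 * C by lra.
rewrite mulrC ler_pdivrMr// => h4.
by have := dP x Kx xd; rewrite ltr_norml => /andP[h5 _]; lra.
Qed.

(* Viscosity form of [|Du| <= Q], tested with quadratic functions only. *)
Definition touching_bound u (Q : R) := forall a z x, 0 < a -> Om x ->
  (forall x', closure Om x' ->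
    u x' - a * dotv (x' - z) (x' - z) <= u x - a * dotv (x - z) (x - z)) ->
  `|(a *+ 2) *: (x - z)| <= Q.

(** In [3 * C], one [C] bounds [- u] and two come from the coupling term. *)
Lemma sub_touching_bound H eps g u w (C Q : R) : 0 < eps ->
  dirichlet_sub Om (system_eq H eps w) g u ->
  (forall x, closure Om x -> `|u x| <= C) ->
  (forall x, closure Om x -> w x - u x <= (2 * C) * eps) ->
  (forall xi p, H xi p <= 3 * C -> `|p| <= Q) ->
  touching_bound u Q.
Proof.
move=> e0 su uC uw HQ a z x a0 Ox xmax; have Kx := subset_closure Ox.
have [|] := dirichlet_sub_quad su Kx xmax; last first.
  by move=> [/(interior_not_boundary Ox)].
rewrite /system_eq => h; apply: (HQ (eps^-1 *: x)).
have /ler_normlP[h3 _] := uC x Kx.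
have := uw x Kx; rewrite -ler_pdivrMr// mulrC => h4; lra.
Qed.

(** Over [N] equal steps the quadratic errors add up to [B / N], which vanishes as [N] grows. *)
Lemma subdivision_le (f : R -> R) (A B : R) : 0 <= B ->
  (forall s t, 0 <= s <= 1 -> 0 <= t <= 1 ->
    f t - f s <= A * `|t - s| + B * `|t - s| ^+ 2) ->
  f 1 - f 0 <= A.
Proof.
move=> B0 H; rewrite leNgt; apply/negP => gap.
pose N := (Num.truncn (B / (f 1 - f 0 - A))).+1.
have NB : B / (f 1 - f 0 - A) < N%:R by exact: truncnS_gt.
have N0 : 0 < N%:R :> R by rewrite ltr0n.
have step k : (k <= N)%N ->
    f (k%:R / N%:R) - f 0 <= k%:R * (A / N%:R + B / N%:R ^+ 2).
  elim: k => [|k IH] kN; first by rewrite !mul0r subrr.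
  have h := IH (ltnW kN).
  have in01 m : (m <= N)%N -> 0 <= (m%:R / N%:R : R) <= 1.
    by move=> mN; rewrite divr_ge0 ?ler0n//= ler_pdivrMr// mul1r ler_nat.
  have := H _ _ (in01 _ (ltnW kN)) (in01 _ kN).
  have -> : k.+1%:R / N%:R - k%:R / N%:R = N%:R^-1 :> R.
    by rewrite -mulrBl -natrB ?subSnn ?mul1r.
  rewrite (ger0_norm (_ : 0 <= N%:R^-1)) ?invr_ge0 ?ler0n//.
  rewrite exprVn -[in X in _ -> _ <= X]natr1 mulrDl mul1r; lra.
have := step N (leqnn N); rewrite divff ?gt_eqF//.
have -> : N%:R * (A / N%:R + B / N%:R ^+ 2) = A + B / N%:R.
  by field; rewrite gt_eqF.
have : B / N%:R < f 1 - f 0 - A.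
  by rewrite ltr_pdivrMr// mulrC -ltr_pdivrMr//; lra.
lra.
Qed.

End AprioriEstimates.

(** * Lipschitz bound along chords *)

Section Chords.
Variables (R : realType) (n : nat) (Om : set 'rV[R]_n).
Implicit Types (x y z : 'rV[R]_n) (u : 'rV[R]_n -> R).

Definition chord_in x y := forall t : R, 0 <= t <= 1 -> Om (x + t *: (y - x)).

Lemma chord_tube x y : open Om -> chord_in x y ->
  exists2 r : R, 0 < r & forall (t : R) z, 0 <= t <= 1 ->
    `|z - (x + t *: (y - x))| < r -> Om z.
Proof.
move=> oOm xy.
pose P (e t : R) := forall z, `|z - (x + t *: (y - x))| < e -> Om z.
have [|d d0 dP] := @compact_uniform_scale R R `[0, 1]%classic P
    (@segment_compact _ _ _).
  move=> t; rewrite /= in_itv /= => /(xy t) Ot.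
  have [r r0 rP] := open_normE oOm Ot.
  pose s := r / 2 / (`|y - x| + 1).
  have yx1 : 0 < `|y - x| + 1 by rewrite ltr_wpDl.
  have s0 : 0 < s by rewrite !divr_gt0.
  exists (Num.min s (r / 2)); first by rewrite lt_min s0 divr_gt0.
  move=> t' e _; rewrite lt_min => /andP[t's _] e0; rewrite lt_min => /andP[_ er].
  move=> z zt'; apply: rP.
  have h : `|t' - t| * `|y - x| <= r / 2.
    rewrite -[leRHS](@divfK _ (`|y - x| + 1)) ?gt_eqF//.
    by rewrite ler_pM// ?ltW// ltrDl.
  have := ler_distD (x + t' *: (y - x)) z (x + t *: (y - x)).
  have -> : x + t' *: (y - x) - (x + t *: (y - x)) = (t' - t) *: (y - x).
    by rewrite opprD addrACA subrr add0r scalerBl.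
  rewrite normrZ; lra.
exists (d / 2); first lra.
move=> t z t01; apply: dP; [|lra|lra].
by rewrite /= in_itv.
Qed.

Lemma dotv_sqrD x y :
  dotv (x + y) (x + y) = dotv x x + 2 * dotv x y + dotv y y.
Proof. by rewrite dotvDl !dotvDr (dotvC y x); ring. Qed.

(* Sup-convolution: the maximizers of [u - a |. - z|^2] have slope at most [Q],
   so [z |-> max (u - a |. - z|^2)] is Lipschitz along the chord, and it
   converges to [u] as [a] tends to infinity. *)
Lemma chord_lipschitz u (C Q : R) x y :
  open Om -> compact (closure Om) -> 0 <= C -> 0 <= Q ->
  cont_on (closure Om) u -> (forall x, closure Om x -> `|u x| <= C) ->
  touching_bound Om u Q -> chord_in x y ->
  u y - u x <= n%:R * Q * `|y - x|.
Proof.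
move=> oOm cK C0 Q0 cu uC uQ xy; apply/ler_addgt0Pr => eta eta0.
have [r r0 rP] := chord_tube oOm xy.
pose p (t : R) := x + t *: (y - x).
have p0 : p 0 = x by rewrite /p scale0r addr0.
have p1 : p 1 = y by rewrite /p scale1r addrC subrK.
have Op t : 0 <= t <= 1 -> Om (p t) by exact: xy.
have Kp t : 0 <= t <= 1 -> closure Om (p t) by move=> /Op; exact: subset_closure.
have Kx : closure Om x by rewrite -p0; apply: Kp; rewrite lexx ler01.
have [d d0 dP] := cu x Kx eta eta0.
(* [s <= r] keeps the maximizers [X t] in the tube, hence in [Om], where the slope bound applies;
   [s <= d] makes [u (X 0)] close to [u x]. *)
pose s := Num.min d r; have s0 : 0 < s by rewrite lt_min d0.
pose a := (2 * C + 1) / s ^+ 2.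
have a0 : 0 < a by rewrite divr_gt0 ?exprn_gt0//; lra.
have aC : 2 * C < a * s ^+ 2.
  by rewrite divfK ?gt_eqF ?exprn_gt0//; lra.
have K0 : closure Om !=set0 by exists x.
have /choice[X XP] : forall t, exists x', closure Om x' /\
    forall x'', closure Om x'' -> u x'' - a * dotv (x'' - p t) (x'' - p t) <=
      u x' - a * dotv (x' - p t) (x' - p t).
  by move=> t; have [x' Kx' x'P] := quad_max cK a (p t) K0 cu; exists x'.
have near t : 0 <= t <= 1 -> `|X t - p t| < s /\
    u (p t) <= u (X t) - a * dotv (X t - p t) (X t - p t).
  move=> t01; have [KX Xmax] := XP t.
  exact: (quad_max_near s0 C0 uC aC (Kp t t01) KX Xmax).
pose f t := u (X t) - a * dotv (X t - p t) (X t - p t).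
have ff : f 1 - f 0 <= n%:R * Q * `|y - x|.
  apply: (@subdivision_le R f _ (n%:R * a * `|y - x| ^+ 2)).
    by rewrite mulr_ge0 ?exprn_ge0// mulr_ge0// ltW.
  move=> t0 t1 t001 t101.
  have [KX1 Xmax1] := XP t1; have [_ Xmax0] := XP t0.
  have [near1 _] := near t1 t101.
  have OX1 : Om (X t1).
    by apply: (rP t1) => //; apply: lt_le_trans near1 _; rewrite ge_min lexx orbT.
  have slope := uQ a (p t1) (X t1) a0 OX1 Xmax1.
  have pp : p t1 - p t0 = (t1 - t0) *: (y - x).
    by rewrite /p opprD addrACA subrr add0r scalerBl.
  have npp : `|p t1 - p t0| = `|t1 - t0| * `|y - x| by rewrite pp normrZ.
  (* [X t1] competes in the problem centred at [p t0]. Expanding the square around [p t1], the cross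
     term is the slope at [X t1] paired with [p t1 - p t0], controlled by [Q]; the remainder is
     quadratic in [t1 - t0]. *)
  have := Xmax0 (X t1) KX1.
  have -> : X t1 - p t0 = (X t1 - p t1) + (p t1 - p t0) by rewrite addrA subrK.
  rewrite dotv_sqrD => h.
  have h1 := dotv_le ((a *+ 2) *: (X t1 - p t1)) (p t1 - p t0).
  have h2 := dotv_le (p t1 - p t0) (p t1 - p t0).
  have h3 : n%:R * (`|(a *+ 2) *: (X t1 - p t1)| * `|p t1 - p t0|) <=
      n%:R * (Q * `|p t1 - p t0|) by rewrite ler_wpM2l// ler_wpM2r.
  have h4 : a * dotv (p t1 - p t0) (p t1 - p t0) <=
      a * (n%:R * (`|p t1 - p t0| * `|p t1 - p t0|)).
    by rewrite ler_pM2l//; apply: le_trans h2; exact: ler_norm.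
  have h5 := le_trans (ler_norm _) (le_trans h1 h3).
  rewrite dotvZl -mulr_natr in h5; rewrite npp in h4 h5.
  rewrite /f.
  have -> : n%:R * Q * `|y - x| * `|t1 - t0| = n%:R * (Q * (`|t1 - t0| * `|y - x|)).
    by ring.
  have -> : n%:R * a * `|y - x| ^+ 2 * `|t1 - t0| ^+ 2 =
     a * (n%:R * (`|t1 - t0| * `|y - x| * (`|t1 - t0| * `|y - x|))) by ring.
  lra.
(* It remains to combine [u y <= f 1] with [f 0 <= u (X 0) < u x + eta]. *)
have [] := near 1; first by rewrite ler01 lexx.
have [] := near 0; first by rewrite lexx ler01.
rewrite p0 p1 lt_min => /andP[Xd _] _ _ uy.
have [KX0 _] := XP 0.
have := dP _ KX0 Xd; rewrite ltr_norml => /andP[_ h].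
have : f 0 <= u (X 0).
  by rewrite /f lerBlDr lerDl mulr_ge0 ?dotv_ge0// ltW.
rewrite /f p1 in ff *; lra.
Qed.

End Chords.

(** * Charts of a Lipschitz boundary *)

Section BoundaryGeometry.
Variables (R : realType) (n : nat) (Om : set 'rV[R]_n).
Implicit Types (x y z e : 'rV[R]_n) (h u g : 'rV[R]_n -> R).

(* [h] is the height above the graph in the direction [e]. *)
Definition epigraph_chart z e h (L r : R) : Prop :=
  [/\ 0 < L, 0 < r, `|e| <= 1, forall x t, h (x + t *: e) = h x + t &
    (forall x y, `|h x - h y| <= L * `|x - y|) /\
    (forall x, `|x - z| < r -> Om x <-> 0 < h x)].

Lemma boundary_chart z : lipschitz_boundary Om -> boundary Om z ->
  exists e h L r, epigraph_chart z e h L r.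
Proof.
move=> lip /lip[e [gamma [e1 [M0 [_ gammaP]] /near_norm_ballP[r r0 rP]]]].
(* [lipschitz] gives its estimate for constants beyond [M0]; [M] is such a constant and positive. *)
pose M := `|M0| + 1.
have M0M : M0 < M by rewrite ltr_pwDr// ler_norm.
have Mpos : 0 < M by rewrite ltr_wpDl.
have glip x y : `|gamma x - gamma y| <= M * `|x - y|.
  by apply: (gammaP M M0M (x, y)).
have ee : dotv e e = 1.
  by rewrite -[LHS]sqr_sqrtr ?dotv_ge0// -/(enorm e) e1 expr1n.
have en : `|e| <= 1 by rewrite -e1; exact: norm_le_enorm.
pose h x := dotv x e - gamma (x - dotv x e *: e).
have dl x : `|dotv x e| <= n%:R * `|x|.
  apply: (le_trans (dotv_le _ _)); rewrite ler_wpM2l//.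
  by rewrite ler_piMr.
(* In the sup norm, [dotv x e] has Lipschitz constant [n%:R] and [gamma] of the projection has
   constant [M * (1 + n%:R)]; the last [1] makes [L] positive. *)
exists e, h, (n%:R + M * (1 + n%:R) + 1), r; split=> //.
- by rewrite ltr_wpDl// addr_ge0// mulr_ge0// ?ltW// addr_ge0.
- move=> x t; rewrite /h dotvDl dotvZl ee mulr1 scalerDl opprD addrACA subrr addr0.
  ring.
split; last first.
  by move=> x /rP ->; rewrite /h subr_gt0.
move=> x y.
have hdiff : h x - h y = dotv (x - y) e -
    (gamma (x - dotv x e *: e) - gamma (y - dotv y e *: e)).
  by rewrite /h dotvDl dotvNl; ring.
have h1 := dl (x - y).
have h2 : `|gamma (x - dotv x e *: e) - gamma (y - dotv y e *: e)| <=
    M * ((1 + n%:R) * `|x - y|).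
  apply: (le_trans (glip _ _)); rewrite ler_pM2l//.
  have -> : x - dotv x e *: e - (y - dotv y e *: e) =
      (x - y) - dotv (x - y) e *: e.
    by rewrite dotvDl dotvNl scalerBl !opprD !opprK addrACA.
  apply: (le_trans (ler_normB _ _)); rewrite mulrDl mul1r lerD2l normrZ.
  by apply: le_trans h1; rewrite ler_piMr.
rewrite hdiff; apply: (le_trans (ler_normB _ _)).
have := normr_ge0 (x - y); lra.
Qed.

Lemma chart_chord z e h (L r : R) x y : epigraph_chart z e h L r ->
  0 < h x -> `|x - z| + `|y - x| < r ->
  (forall t, 0 <= t <= 1 -> 0 < h (x + t *: (y - x))) -> chord_in Om x y.
Proof.
move=> [L0 r0 e1 he [hL hOm]] hx xr hpos t t01.
have /andP[t0 t1] := t01.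
apply/(hOm _ _).2; last exact: hpos.
have -> : x + t *: (y - x) - z = (x - z) + t *: (y - x) by rewrite addrAC.
apply: le_lt_trans (ler_normD _ _) _; apply: le_lt_trans xr.
by rewrite lerD2l normrZ (ger0_norm t0) ler_piMl.
Qed.

End BoundaryGeometry.

(** * Lipschitz bounds up to the boundary, and the barrier *)

Section LocalLipschitz.
Variables (R : realType) (n : nat) (Om : set 'rV[R]_n).
Hypotheses (oOm : open Om) (lipOm : lipschitz_boundary Om).
Implicit Types (x y z e : 'rV[R]_n) (h u g : 'rV[R]_n -> R).

(** Near a boundary point the segment from [x] to [y] may leave [Om]. Three chords replace it: up by
    [T], which is [L] times the distance from [x] to [y], along [e], then across, then down. The
    crossing loses at most [T] of height, so it stays above the graph. The total length gives the
    factor [2 * L + 1]. *)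
Lemma local_lipschitz z : closure Om z ->
  exists rho L : R, [/\ 0 < rho, 0 <= L & forall u B, 0 <= B ->
    (forall x y, chord_in Om x y -> u y - u x <= B * `|y - x|) ->
    forall x y, Om x -> Om y -> `|x - z| < rho -> `|y - z| < rho ->
      u y - u x <= L * B * `|y - x|].
Proof.
move=> Kz; have [Oz|nOz] := pselect (Om z).
  have [r r0 rP] := open_normE oOm Oz.
  exists r, 1; split=> // u B B0 uB x y _ _ xz yz; rewrite mul1r; apply: uB.
  move=> t /andP[t0 t1]; apply: rP.
  have -> : x + t *: (y - x) - z = (1 - t) *: (x - z) + t *: (y - z).
    by apply/rowP => i; rewrite !mxE; ring.
  apply: le_lt_trans (ler_normD _ _) _; rewrite !normrZ !ger0_norm ?subr_ge0//.
  have [->|tn0] := eqVneq t 0; first by rewrite subr0 mul1r mul0r addr0.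
  have tpos : 0 < t by rewrite lt_def tn0.
  have h1 : (1 - t) * `|x - z| <= (1 - t) * r by rewrite ler_wpM2l ?subr_ge0// ltW.
  have h2 : t * `|y - z| < t * r by rewrite ltr_pM2l.
  lra.
have [e [h [L [r ch]]]] := boundary_chart lipOm (conj Kz nOz).
have [L0 r0 e1 he [hL hOm]] := ch.
have L4 : 0 < 4 + 4 * L by rewrite addr_gt0 ?mulr_gt0.
(* An offset [rho] from [z], a crossing shorter than [2 * rho] and two vertical moves
   [T < 2 * (L * rho)] together still fit in the chart. *)
pose rho := r / (4 + 4 * L); have rho0 : 0 < rho by rewrite divr_gt0.
have rE : 4 * rho + 4 * (L * rho) = r.
  by rewrite /rho; field; rewrite gt_eqF.
have Lr0 : 0 < L * rho by rewrite mulr_gt0.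
have inr x : `|x - z| < rho -> `|x - z| < r.
  by move=> xz; lra.
exists rho, (2 * L + 1); split=> //; first by rewrite addr_ge0 ?mulr_ge0 ?ltW.
move=> u B B0 uB x y Ox Oy xz yz.
have hx : 0 < h x by apply/(hOm _ (inr _ xz)).
have hy : 0 < h y by apply/(hOm _ (inr _ yz)).
pose d := `|y - x|; pose T := L * d.
have d0 : 0 <= d by rewrite normr_ge0.
have T0 : 0 <= T by rewrite mulr_ge0 // ltW.
have d2 : d < 2 * rho.
  by rewrite /d; have := ler_distD z y x; rewrite (distrC z x); lra.
have T2 : T < 2 * (L * rho) by rewrite /T mulrCA ltr_pM2l.
have Te : `|T *: e| <= T by rewrite normrZ ger0_norm// ler_piMr.
have c1 : chord_in Om x (x + T *: e).
  have E : x + T *: e - x = T *: e by rewrite addrC addKr.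
  apply: (chart_chord ch hx); first by rewrite E; lra.
  move=> t /andP[t0 t1]; rewrite E scalerA he ltr_pwDl// mulr_ge0//.
have hxT : 0 < h (x + T *: e) by rewrite he; lra.
have hyT : 0 < h (y + T *: e) by rewrite he; lra.
have c2 : chord_in Om (x + T *: e) (y + T *: e).
  have E : y + T *: e - (x + T *: e) = y - x.
    by rewrite opprD addrACA subrr addr0.
  apply: (chart_chord ch hxT).
    rewrite E -/d addrAC; have := ler_normD (x - z) (T *: e); lra.
  move=> t /andP[t0 t1]; rewrite E.
  have := hL (x + T *: e + t *: (y - x)) (x + T *: e).
  rewrite (_ : x + _ + _ - _ = t *: (y - x)); last by rewrite addrC addKr.
  rewrite normrZ (ger0_norm t0) -/d he ler_norml => /andP[h1 _].
  have : L * (t * d) <= T by rewrite /T ler_pM2l// ler_piMl.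
  lra.
have c3 : chord_in Om (y + T *: e) y.
  have E : y - (y + T *: e) = - (T *: e) by rewrite opprD addrA subrr add0r.
  apply: (chart_chord ch hyT).
    rewrite E normrN addrAC; have := ler_normD (y - z) (T *: e); lra.
  move=> t /andP[t0 t1]; rewrite E.
  have -> : y + T *: e + t *: - (T *: e) = y + ((1 - t) * T) *: e.
    by apply/rowP => i; rewrite !mxE; ring.
  by rewrite he ltr_pwDl// mulr_ge0// subr_ge0.
have u1 := uB _ _ c1; have u2 := uB _ _ c2; have u3 := uB _ _ c3.
rewrite (_ : x + T *: e - x = T *: e) in u1; last by rewrite addrC addKr.
rewrite (_ : y + T *: e - (x + T *: e) = y - x) in u2; last first.
  by rewrite opprD addrACA subrr addr0.
rewrite (_ : y - (y + T *: e) = - (T *: e)) in u3; last first.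
  by rewrite opprD addrA subrr add0r.
rewrite normrN in u3.
have BT : B * `|T *: e| <= B * T by rewrite ler_wpM2l.
have -> : (2 * L + 1) * B * `|y - x| = B * T + B * `|y - x| + B * T.
  by rewrite /T /d; ring.
lra.
Qed.

Lemma lipschitz_closure u B rho z : 0 <= B -> cont_on (closure Om) u ->
  (forall x y, Om x -> Om y -> `|x - z| < rho -> `|y - z| < rho ->
    u y - u x <= B * `|y - x|) ->
  forall x y, closure Om x -> closure Om y ->
    `|x - z| < rho -> `|y - z| < rho -> u y - u x <= B * `|y - x|.
Proof.
move=> B0 cu uB x y Kx Ky xz yz; apply/ler_addgt0Pr => eta eta0.
have B1 : 0 < B + 1 by rewrite ltr_wpDl.
have s0 : 0 < eta / 4 / (B + 1) by rewrite !divr_gt0.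
have approx w : closure Om w -> `|w - z| < rho -> exists w', [/\ Om w',
    `|w' - z| < rho, B * `|w' - w| <= eta / 4 & `|u w' - u w| < eta / 4].
  move=> Kw wz; have [|d d0 dP] := cu w Kw (eta / 4); first lra.
  pose m := Num.min d (Num.min (rho - `|w - z|) (eta / 4 / (B + 1))).
  have [|w' Ow'] := @closure_normE R n Om w m Kw.
    by rewrite !lt_min d0 s0 subr_gt0 wz.
  rewrite !lt_min => /and3P[w'd w'r w's]; exists w'; split=> //.
  - by have := ler_distD w w' z; lra.
  - rewrite ltr_pdivlMr// in w's.
    apply: le_trans (ltW w's); rewrite mulrC ler_wpM2l//; lra.
  - exact/dP/w'd/subset_closure.
have [x' [Ox' x'z Bx' /ltr_normlP[ux1 ux2]]] := approx x Kx xz.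
have [y' [Oy' y'z By' /ltr_normlP[uy1 uy2]]] := approx y Ky yz.
have h := uB x' y' Ox' Oy' x'z y'z.
have h2 : B * `|y' - x'| <= B * (`|y' - y| + (`|y - x| + `|x' - x|)).
  rewrite ler_wpM2l//; apply: le_trans (ler_distD y _ _) _; rewrite lerD2l.
  by rewrite (distrC x'); exact: ler_distD.
rewrite !mulrDr in h2; lra.
Qed.

(** The radius and [L] are chosen before [u], which makes the estimate an equicontinuity statement
    for the whole family. *)
Lemma equilipschitz z : compact (closure Om) -> closure Om z ->
  exists2 rho : R, 0 < rho & exists2 L, 0 <= L &
    forall u (C Q : R), 0 <= C -> 0 <= Q -> cont_on (closure Om) u ->
      (forall x, closure Om x -> `|u x| <= C) -> touching_bound Om u Q ->
      forall x, closure Om x -> `|x - z| < rho ->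
        `|u x - u z| <= L * (n%:R * Q) * `|x - z|.
Proof.
move=> cK Kz; have [rho [L [rho0 L0 LP]]] := local_lipschitz Kz.
exists rho => //; exists L => // u C Q C0 Q0 cu uC uQ x Kx xz.
have nQ0 : 0 <= n%:R * Q by rewrite mulr_ge0.
have zz : `|z - z| < rho by rewrite subrr normr0.
have H := @lipschitz_closure u (L * (n%:R * Q)) rho z (mulr_ge0 L0 nQ0) cu.
have {}H := H (LP u _ nQ0 (fun x y =>
  @chord_lipschitz R n Om u C Q x y oOm cK C0 Q0 cu uC uQ)).
have h1 := H x z Kx Kz xz zz; have h2 := H z x Kz Kx zz xz.
by rewrite ler_norml (distrC z x) in h1 *; apply/andP; split; lra.
Qed.

(* The test quadratic is centred at the exterior point [z - t e], at distance at
   least [t / L] from the closure, so that its slopes there exceed [Q]. *)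
Lemma sub_boundary_le (F : 'rV[R]_n -> R -> 'rV[R]_n -> R) g u (C Q : R) z :
  compact (closure Om) -> 0 <= C -> 0 < Q ->
  cont_on (closure Om) u -> cont_on (boundary Om) g ->
  (forall x, closure Om x -> `|u x| <= C) ->
  (forall x p, closure Om x -> F x (u x) p <= 0 -> `|p| <= Q) ->
  dirichlet_sub Om F g u -> boundary Om z -> u z <= g z.
Proof.
move=> cK C0 Q0 cu cg uC FQ su bz; rewrite leNgt; apply/negP => gu.
have Kz : closure Om z by case: bz.
have [e [h [L [r ch]]]] := boundary_chart lipOm bz.
have [L0 r0 e1 he [hL hOm]] := ch.
(* [u z - gam] and [g z + gam] are the same midpoint, so [u x <= g x] is impossible at boundary
   points near [z]. *)
pose gam := (u z - g z) / 2; have gam0 : 0 < gam by rewrite /gam; lra.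
have [d1 d10 d1P] := cu z Kz gam gam0.
have [d2 d20 d2P] := cg z bz gam gam0.
pose d := Num.min r (Num.min d1 d2).
have d0 : 0 < d by rewrite !lt_min r0 d10.
have K0 : closure Om !=set0 by exists z.
pose N : R := n%:R + 1; have N1 : 1 <= N by rewrite lerDr.
(* As [dotv e e <= N], the quadratic takes a value at most [a * (d ^+ 2 / 16)] at [z]; moreover
   [t <= d / 4]. *)
pose t : R := d / (4 * N).
have t0 : 0 < t by rewrite divr_gt0//; lra.
have td : t * (4 * N) = d by rewrite /t divfK// gt_eqF//; lra.
(* The first summand outweighs the oscillation [2 * C] of [u] and keeps the maximizer within [d / 2]
   of [y]; the second turns the distance [t / L] into a slope of at least [2 * Q]. *)
pose a : R := 16 * C / d ^+ 2 + L * Q / t.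
have a0 : 0 < a.
  apply: ltr_wpDl; first by rewrite divr_ge0 ?sqr_ge0 ?mulr_ge0.
  by apply: divr_gt0 => //; exact: mulr_gt0.
have [y zy] : exists y, z - y = t *: e.
  by exists (z - t *: e); rewrite opprB addrC subrK.
have [x Kx xmax] := quad_max cK a y K0 cu.
have xy : `|x - y| ^+ 2 <= (d / 2) ^+ 2.
  have := xmax z Kz; rewrite zy dotvZl dotvZr => hz.
  have ee : dotv e e <= n%:R.
    apply: (le_trans (ler_norm _)); apply: (le_trans (dotv_le e e)).
    by rewrite ler_piMr// mulr_ile1.
  have /ler_normlP[_ h1] := uC x Kx; have /ler_normlP[h2 _] := uC z Kz.
  have h3 : a * `|x - y| ^+ 2 <= a * dotv (x - y) (x - y).
    by rewrite ler_pM2l// norm_sqr_le_dotv.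
  have h4 : a * (t * (t * dotv e e)) <= a * (t * (t * N)).
    by rewrite !ler_pM2l//; rewrite /N; lra.
  have tN : t * (t * N) <= d ^+ 2 / 16.
    have -> : d ^+ 2 / 16 = t * (t * N) * N by rewrite -td; field.
    have N0 : 0 < N by lra.
    rewrite ler_peMr//; apply: mulr_ge0; first exact: ltW.
    by apply: mulr_ge0; exact: ltW.
  have h5 : a * (t * (t * N)) <= a * (d ^+ 2 / 16) by rewrite ler_pM2l.
  have h6 : 2 * C <= a * (d ^+ 2 / 8).
    have -> : 2 * C = 16 * C / d ^+ 2 * (d ^+ 2 / 8).
      by field; rewrite gt_eqF.
    rewrite ler_wpM2r//; first by rewrite divr_ge0 ?sqr_ge0.
    by rewrite lerDl ltW// divr_gt0// mulr_gt0.
  have h7 : a * `|x - y| ^+ 2 <= a * (d / 2) ^+ 2 by lra.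
  by rewrite ler_pM2l in h7.
have {}xy : `|x - y| <= d / 2.
  have d2' : 0 <= d / 2 by lra.
  by move: xy; rewrite ler_sqr ?nnegrE.
have xz : `|x - z| < d.
  have -> : x - z = (x - y) + - (t *: e).
    by rewrite -zy opprB addrA subrK.
  apply: le_lt_trans (ler_normD _ _) _; rewrite normrN normrZ gtr0_norm//.
  have : t * `|e| <= t by rewrite ler_piMr// ltW.
  have : t * 4 <= t * (4 * N) by rewrite ler_pM2l//; lra.
  lra.
move: (xz); rewrite !lt_min => /and3P[xr xd1 xd2].
have hz : h z <= 0.
  rewrite leNgt; apply/negP => /(hOm z); rewrite subrr normr0 => /(_ r0).
  by case: bz.
have hy : h y <= - t.
  have := he y t; rewrite -zy addrC subrK; lra.
(* Otherwise [h] would be negative around [x], leaving no point of [Om] there, although [x] is in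
   the closure. *)
have hx : 0 <= h x.
  rewrite leNgt; apply/negP => hx0.
  pose m := Num.min (r - `|x - z|) (- h x / L).
  have [|w Ow] := @closure_normE R n Om x m Kx.
    by rewrite lt_min subr_gt0 xr divr_gt0// oppr_gt0.
  rewrite lt_min => /andP[wr wL].
  have : 0 < h w by apply/(hOm w) => //; have := ler_distD x w z; lra.
  have /ler_normlP[_] := hL w x; move: wL; rewrite ltr_pdivlMr// mulrC; lra.
have txy : t <= L * `|x - y| by have /ler_normlP[_] := hL x y; lra.
have [hF|[bx ux]] := dirichlet_sub_quad su Kx xmax; last first.
  have /ltr_normlP[h1 h2] := d1P x Kx xd1; have /ltr_normlP[h3 h4] := d2P x bx xd2.
  rewrite /gam in h1 h2 h3 h4; lra.
have := FQ x _ Kx hF; rewrite normrZ ger0_norm; last by rewrite mulrn_wge0// ltW.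
have h1 : (a *+ 2) * t <= (a *+ 2) * (L * `|x - y|).
  by rewrite ler_wpM2l// mulrn_wge0// ltW.
have h2 : L * Q <= a * t.
  rewrite -[leLHS](@divfK _ t) ?gt_eqF// ler_pM2r// lerDr.
  by rewrite divr_ge0 ?sqr_ge0// mulr_ge0.
have LQ : 0 < L * Q by rewrite mulr_gt0.
rewrite leNgt => /negP; apply.
rewrite -(ltr_pM2l L0) mulrCA; apply: lt_le_trans h1.
by rewrite mulrnAl -mulr_natr; lra.
Qed.

End LocalLipschitz.

(** * Lower limits and perturbed test functions *)

Section LowerLimit.
Variables (R : realType).

(** [S] collects the eventual lower bounds of [f] and [l] is its supremum; were the second property
    false, [l + eta] would again lie in [S]. *)
Lemma liminf_at0 (f : R -> R) C : (forall e, 0 < e -> `|f e| <= C) ->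
  exists l,
    (forall eta, 0 < eta -> exists2 d, 0 < d &
       forall e, 0 < e -> e < d -> l - eta <= f e) /\
    (forall eta d, 0 < eta -> 0 < d ->
       exists e, [/\ 0 < e, e < d & f e <= l + eta]).
Proof.
move=> fC.
pose S := [set a : R | exists2 d, 0 < d & forall e, 0 < e -> e < d -> a <= f e].
have Sub : ubound S C.
  move=> a [d d0 da]; have d2 : 0 < d / 2 by lra.
  have h : a <= f (d / 2) by apply: da => //; lra.
  by have /ler_normlP[_ h2] := fC _ d2; lra.
have S0 : S (- C).
  by exists 1 => // e e0 _; have /ler_normlP[h _] := fC _ e0; lra.
have supS : has_sup S by split; [exists (- C)|exists C].
exists (sup S); split.
  move=> eta eta0; have [a [d d0 da] la] := sup_adherent eta0 supS.
  by exists d => // e e0 ed; have := da e e0 ed; lra.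
move=> eta d eta0 d0; apply: contrapT => H.
suff : S (sup S + eta) by move=> /(sup_upper_bound supS); lra.
exists d => // e e0 ed; rewrite leNgt; apply/negP => lt; apply: H.
by exists e; split=> //; exact: ltW.
Qed.

(** The lower bound is uniform in [x], since it is applied at minimum points that move with [e]; the
    upper one is used at a fixed point, for some arbitrarily small scale. *)
Definition is_liminf (V : normedModType R) (K : set V) (f : R -> V -> R)
    (m : V -> R) : Prop :=
  (forall eta, 0 < eta -> exists2 d, 0 < d &
     forall x e, K x -> 0 < e -> e < d -> m x - eta <= f e x) /\
  (forall x eta d, K x -> 0 < eta -> 0 < d ->
     exists e, [/\ 0 < e, e < d & f e x <= m x + eta]).

(** Equicontinuity passes to the pointwise lower limit and, with compactness, makes the pointwise
    lower bound uniform. *)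
Lemma liminf_equicontinuous (V : normedModType R) (K : set V)
    (f : R -> V -> R) C :
  compact K -> (forall e x, 0 < e -> K x -> `|f e x| <= C) ->
  (forall z eta, K z -> 0 < eta -> exists2 r : R, 0 < r &
     forall e x, 0 < e -> K x -> `|x - z| < r -> `|f e x - f e z| <= eta) ->
  exists m, cont_on K m /\ is_liminf K f m.
Proof.
move=> cK fC feq.
have /choice[m mP] : forall x, exists l, K x ->
    (forall eta, 0 < eta -> exists2 d, 0 < d &
       forall e, 0 < e -> e < d -> l - eta <= f e x) /\
    (forall eta d, 0 < eta -> 0 < d ->
       exists e, [/\ 0 < e, e < d & f e x <= l + eta]).
  move=> x; have [Kx|nKx] := pselect (K x); last by exists 0 => /nKx.
  have [l lP] := @liminf_at0 (fun e => f e x) C (fun e e0 => fC e x e0 Kx).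
  by exists l.
have m_le x z eta : 0 < eta -> K x -> K z ->
    (forall e, 0 < e -> f e x - f e z <= eta) -> m x <= m z + eta *+ 3.
  move=> eta0 Kx Kz fxz; have [d d0 dP] := (mP x Kx).1 eta eta0.
  have [e [e0 ed fz]] := (mP z Kz).2 eta d eta0 d0.
  have := dP e e0 ed; have := fxz e e0; rewrite mulrS mulr2n; lra.
have m_near z eta : K z -> 0 < eta -> exists2 r : R, 0 < r & forall x, K x ->
    `|x - z| < r -> (forall e, 0 < e -> `|f e x - f e z| <= eta) /\
    `|m x - m z| <= eta *+ 3.
  move=> Kz eta0; have [r r0 rP] := feq z eta Kz eta0.
  exists r => // x Kx xz; have fxz e (e0 : 0 < e) := rP e x e0 Kx xz.
  split=> //.
  have h1 : m x <= m z + eta *+ 3.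
    by apply: m_le => // e /fxz; exact: le_trans (ler_norm _).
  have h2 : m z <= m x + eta *+ 3.
    by apply: m_le => // e /fxz; rewrite distrC; exact: le_trans (ler_norm _).
  by rewrite ler_norml; apply/andP; split; lra.
exists m; split.
  move=> z Kz eta eta0; have [|r r0 rP] := m_near z (eta / 4) Kz; first lra.
  exists r => // x Kx xz; have [_] := rP x Kx xz; rewrite mulrS mulr2n; lra.
split; last by move=> x eta d Kx; exact: (mP x Kx).2.
move=> eta eta0.
apply: (@compact_uniform_scale R V K (fun e x => m x - eta <= f e x)) => // z Kz.
(* Three fifths for the oscillation of [m], one for that of [f], one for the lower limit at [z]. *)
have [|r r0 rP] := m_near z (eta / 5) Kz; first lra.
have [|d d0 dP] := (mP z Kz).1 (eta / 5); first lra.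
exists (Num.min r d); first by rewrite lt_min r0.
move=> x e Kx; rewrite !lt_min => /andP[xr _] e0 /andP[_ ed].
have [/(_ e e0)/ler_normlP[h1 h2]] := rP x Kx xr.
rewrite mulrS mulr2n => /ler_normlP[h3 h4]; have := dP e e0 ed; lra.
Qed.

End LowerLimit.

(** * Minimization with doubled variables *)

Section Doubling.
Variables (R : realType) (n : nat).

Lemma cont_on_comp (U V W : normedModType R) (K : set U) (f : V -> W)
    (g : U -> V) :
  cont_on setT f -> cont_on K g -> cont_on K (fun x => f (g x)).
Proof.
move=> cf cg x Kx eta eta0; have [d d0 dP] := cf (g x) I eta eta0.
have [r r0 rP] := cg x Kx d d0; exists r => // y Ky yx.
exact/dP/rP.
Qed.

Lemma cont_on_fst (U V W : normedModType R) (K : set U) (L : set V) (f : U -> W) :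
  cont_on K f -> cont_on (K `*` L) (fun q : U * V => f q.1).
Proof.
move=> cf x [Kx _] eta eta0; have [d d0 dP] := cf x.1 Kx eta eta0.
exists d => // y [Ky _] yx; apply: dP => //.
by apply: le_lt_trans yx; rewrite prod_normE le_max lexx.
Qed.

Lemma cont_on_snd (U V W : normedModType R) (K : set U) (L : set V) (f : V -> W) :
  cont_on L f -> cont_on (K `*` L) (fun q : U * V => f q.2).
Proof.
move=> cf x [_ Lx] eta eta0; have [d d0 dP] := cf x.2 Lx eta eta0.
exists d => // y [_ Ly] yx; apply: dP => //.
by apply: le_lt_trans yx; rewrite prod_normE le_max lexx orbT.
Qed.

Lemma cont_on_id (V : normedModType R) (K : set V) : cont_on K (fun x : V => x).
Proof. by move=> x _ eta eta0; exists eta. Qed.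

Lemma doubling_min (K : set 'rV[R]_n) (w v : bool -> 'rV[R]_n -> R) (A r : R) :
  compact K -> K !=set0 -> 0 <= r ->
  (forall b, cont_on K (w b)) -> (forall b, continuous (v b)) ->
  exists b x y, [/\ K x, `|y| <= r & forall b' x' y', K x' -> `|y'| <= r ->
    w b x - v b y + A * dotv (x - y) (x - y) <=
    w b' x' - v b' y' + A * dotv (x' - y') (x' - y')].
Proof.
move=> cK [k Kk] r0 cw cv.
pose B := K `*` [set y : 'rV[R]_n | `|y| <= r].
pose Psi b (q : 'rV[R]_n * 'rV[R]_n) :=
  w b q.1 - v b q.2 + A * dotv (q.1 - q.2) (q.1 - q.2).
have cB : compact B := compact_setX cK (@compact_norm_le R n r).
have B0 : B !=set0 by exists (k, 0); split=> //=; rewrite normr0.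
have cPsi b : cont_on B (Psi b).
  apply: cont_onD.
    apply: cont_onD; first exact: cont_on_fst.
    apply/cont_onN/cont_on_snd/(@cont_onS _ _ _ _ setT) => //.
    exact/continuousE.
  apply: (@cont_on_comp _ _ _ B (fun z : 'rV[R]_n => A * dotv z z)
    (fun q => q.1 - q.2)).
    move=> x _ eta eta0; have [d d0 dP] := @cont_quad R n setT A 0 x I eta eta0.
    by exists d => // y _ yx; have := dP y I yx; rewrite !subr0.
  apply: cont_onD; first exact: (cont_on_fst (@cont_on_id _ K)).
  exact: (cont_onN (cont_on_snd (@cont_on_id _ _))).
have [q1 [K1 r1] m1] := compact_min B0 cB (cPsi true).
have [q2 [K2 r2] m2] := compact_min B0 cB (cPsi false).
have [le|/ltW le] := leP (Psi true q1) (Psi false q2).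
  exists true, q1.1, q1.2; split=> // -[] x' y' Kx' ry'.
    exact: (m1 (x', y')).
  exact: (le_trans le (m2 (x', y') _)).
exists false, q2.1, q2.2; split=> // -[] x' y' Kx' ry'.
  exact: (le_trans le (m1 (x', y') _)).
exact: (m2 (x', y')).
Qed.

End Doubling.

Lemma bool_uniform (R : realType) (T : Type) (P : bool -> R -> T -> Prop) :
  (forall b x (d d' : R), d' <= d -> P b d x -> P b d' x) ->
  (forall b, exists2 d : R, 0 < d & forall x, P b d x) ->
  exists2 d : R, 0 < d & forall b x, P b d x.
Proof.
move=> mono HP; have [d d0 dP] := HP true; have [d' d'0 d'P] := HP false.
exists (Num.min d d'); first by rewrite lt_min d0.
by case=> x; [apply: mono (dP x)|apply: mono (d'P x)]; rewrite ge_min lexx ?orbT.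
Qed.

(** * The perturbed test function method *)

Section HomogenizedSupersolution.
Variables (R : realType) (n : nat) (Om : set 'rV[R]_n).
Variables (H : bool -> 'rV[R]_n -> 'rV[R]_n -> R) (Hbar : 'rV[R]_n -> R).
Variables (g : bool -> 'rV[R]_n -> R) (u : bool -> R -> 'rV[R]_n -> R).
Variable m : 'rV[R]_n -> R.

Hypotheses (oOm : open Om) (bOm : bounded_set Om).

Hypothesis Hunif : forall b (Q eta : R), 0 < eta ->
  exists2 d, 0 < d & forall xi xi' p p', `|p| <= Q ->
    `|xi' - xi| < d -> `|p' - p| < d -> `|H b xi' p' - H b xi p| < eta.

(** Reflected Hamiltonians satisfy the second alternative, so the section serves both the lower and
    the upper limit. *)
Hypothesis Hcoercive :
  (forall b (M : R), exists Q : R, forall xi p, H b xi p <= M -> `|p| <= Q) \/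
  (forall b (M : R), exists Q : R, forall xi p, M <= H b xi p -> `|p| <= Q).

Hypothesis cell : forall P, exists (v : bool -> 'rV[R]_n -> R) (V : R),
  [/\ 0 <= V, forall b, continuous (v b), forall b xi, `|v b xi| <= V &
    forall b, viscosity_solution (cell_eq (H b) P (Hbar P) (v (~~ b))) (v b)].

Hypotheses (cg : forall b, cont_on (boundary Om) (g b))
  (cu : forall b (eps : R), 0 < eps -> cont_on (closure Om) (u b eps))
  (su : forall b (eps : R), 0 < eps ->
     dirichlet_super Om (system_eq (H b) eps (u (~~ b) eps)) (g b) (u b eps)).

Hypothesis mlow : forall eta : R, 0 < eta -> exists2 d : R, 0 < d &
  forall b x (eps : R), closure Om x -> 0 < eps -> eps < d -> m x - eta <= u b eps x.

Hypothesis mfreq : forall x (eta d : R), closure Om x -> 0 < eta -> 0 < d ->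
  exists eps : R, [/\ 0 < eps, eps < d & u true eps x <= m x + eta].

(* The common minimum over both components gives
   [(u_b - u_{~~b}) / eps <= v_b - v_{~~b}], so the coupling terms of the two
   equations cancel; the penalization [eps^-2] makes [|x - y| = o(eps)]. *)
Lemma perturbed_test phi Dphi x0 (v : bool -> 'rV[R]_n -> R) (V c eps s : R) :
  C1_closure Om phi Dphi -> closure Om x0 ->
  (forall b, continuous (v b)) -> (forall b xi, `|v b xi| <= V) ->
  (forall b, viscosity_solution
     (cell_eq (H b) (Dphi x0) c (v (~~ b))) (v b)) ->
  0 < eps -> eps < 1 -> 0 <= V -> 2 * V * eps < s -> s <= 1 ->
  exists b x xi q,
    [/\ closure Om x, `|eps^-1 *: x - xi| ^+ 2 < s,
      forall b' x', closure Om x' ->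
        u b eps x - phi x + dotv (x - x0) (x - x0) <=
        u b' eps x' - phi x' + dotv (x' - x0) (x' - x0) + s,
      H b xi (Dphi x0 + q) + (v b xi - v (~~ b) xi) <= c &
      0 <= u b eps x + H b (eps^-1 *: x) (Dphi x - 2 *: (x - x0) + q) +
           (v b xi - v (~~ b) xi) \/
      (boundary Om x /\ g b x <= u b eps x)].
Proof.
move=> cphi Kx0 cv vV vsol e0 e1 V0 Ves s1.
have cK := compact_closure_bounded bOm.
have eN0 : eps != 0 by rewrite gt_eqF.
have [r0 r0P] : exists r0 : R, forall x, closure Om x -> `|x| <= r0.
  have [M [_ MP]] := compact_bounded cK.
  by exists (M + 1) => x Kx; apply: (MP (M + 1)) => //; rewrite ltrDl.
have r00 : 0 <= r0 := le_trans (normr_ge0 _) (r0P x0 Kx0).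
pose A : R := eps^-1 ^+ 2.
have A0 : 0 < A by rewrite exprn_gt0// invr_gt0.
have [cphi1 cphi2 dphi] := cphi.
(* Subtracting the squared distance to [x0] makes the minimum strict and forces [x] towards [x0]. *)
have cphi3 : C1_closure Om (fun x => phi x + (-1) * dotv (x - x0) (x - x0))
    (fun x => Dphi x + ((-1) *+ 2) *: (x - x0)) by exact: C1_closure_quad.
have [/within_continuousE cphi4 _ _] := cphi3.
pose w b x := u b eps x - (phi x + (-1) * dotv (x - x0) (x - x0)).
pose ve b y := eps * v b (eps^-1 *: y).
(* The ball for [y] exceeds the radius of the closure by [1]. Since [x] and [y] turn out to be less
   than [1] apart, [y] is interior to it and is a true local minimum point. *)
have [||||b [x [y [Kx ry xymin]]]] :=
  @doubling_min R n (closure Om) w ve A (r0 + 1) cK.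
- by exists x0.
- by rewrite addr_ge0.
- by move=> b; apply: cont_onD; [exact: cu|exact: cont_onN].
- move=> b; apply/continuousE => z _ eta eta0.
  have [d d0 dP] := (continuousE _).1 (cv b) (eps^-1 *: z) I (eta / eps)
    (divr_gt0 eta0 e0).
  exists (d * eps); first exact: mulr_gt0.
  move=> t _ tz; rewrite /ve -mulrBr normrM gtr0_norm// mulrC -ltr_pdivlMr//.
  apply: dP => //; rewrite -scalerBr normrZ gtr0_norm ?invr_gt0//.
  by rewrite mulrC ltr_pdivrMr.
pose xi := eps^-1 *: y.
have yE : eps *: xi = y by rewrite /xi scalerA divff// scale1r.
pose q := ((- A) *+ 2) *: (x - y).
have inr z : closure Om z -> `|z| <= r0 + 1.
  by move=> /r0P; lra.
have veV b' z : `|ve b' z| <= eps * V.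
  by rewrite normrM gtr0_norm// ler_pM2l.
(* With the competitor [(x, x)], the penalty is at most the oscillation of [ve b]. *)
have dist : A * dotv (x - y) (x - y) <= 2 * V * eps.
  have := xymin b x x Kx (inr _ Kx); rewrite subrr dotv00.
  have /ler_normlP[h1 h2] := veV b x; have /ler_normlP[h3 h4] := veV b y; lra.
have Anorm : A * `|x - y| ^+ 2 < s.
  apply: le_lt_trans Ves; apply: le_trans dist.
  by rewrite ler_pM2l// norm_sqr_le_dotv.
have xyA : `|eps^-1 *: x - xi| ^+ 2 < s.
  by rewrite /xi -scalerBr normrZ exprMn real_normK// num_real.
have xy1 : `|x - y| < 1.
  rewrite -(@ltr_pXn2r _ 2)// ?nnegrE// expr1n.
  apply: le_lt_trans (lt_le_trans Anorm s1).
  rewrite ler_peMl ?sqr_ge0// exprn_ege1// invf_ge1//; exact: ltW.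
exists b, x, xi, q; split=> //.
- move=> b' x' Kx'.
  have := xymin b' x' x' Kx' (inr _ Kx'); rewrite subrr dotv00 /w.
  have /ler_normlP[h1 h2] := veV b' x'; have /ler_normlP[h3 h4] := veV b y.
  have : 0 <= A * dotv (x - y) (x - y) by rewrite mulr_ge0 ?dotv_ge0// ltW.
  lra.
(* For frozen [x], minimality in [y] says, after division by [eps], that [v b] minus this quadratic
   has a local maximum at [xi]; the gradient of the quadratic there is [q]. *)
- have [vsub _] := vsol b _ xi (C1_quad (A * eps) (eps^-1 *: x)).
  have {vsub} := vsub _; rewrite /cell_eq grad_quad.
  have -> : (A * eps *+ 2) *: (xi - eps^-1 *: x) = q.
    rewrite /q /xi -scalerBr scalerA mulNrn scaleNr -scalerN opprB.
    by congr (_ *: _); rewrite mulrnAl mulfK.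
  suff near : \forall z \near xi, v b z -
      A * eps * dotv (z - eps^-1 *: x) (z - eps^-1 *: x) <= v b xi -
      A * eps * dotv (xi - eps^-1 *: x) (xi - eps^-1 *: x).
    by move=> /(_ near); lra.
  have quadE z : A * dotv (x - eps *: z) (x - eps *: z) =
      eps * (A * eps * dotv (z - eps^-1 *: x) (z - eps^-1 *: x)).
    have -> : x - eps *: z = (- eps) *: (z - eps^-1 *: x).
      by rewrite scalerBr scaleNr scalerA mulNr divff// scaleN1r opprK addrC.
    by rewrite dotvZl dotvZr; ring.
  have d0 : 0 < (1 - `|x - y|) / eps by rewrite divr_gt0 ?subr_gt0.
  apply/near_norm_ballP; exists ((1 - `|x - y|) / eps) => // z.
  rewrite ltr_pdivlMr// mulrC => zxi.
  have zr : `|eps *: z| <= r0 + 1.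
    have -> : eps *: z = x + ((y - x) + eps *: (z - xi)).
      by rewrite scalerBr yE addrA [x + _]addrC subrK addrC subrK.
    apply: le_trans (ler_normD _ _) _.
    have h1 := r0P x Kx; have h2 := ler_normD (y - x) (eps *: (z - xi)).
    rewrite normrZ gtr0_norm// (distrC y x) in h2.
    lra.
  have := xymin b x (eps *: z) Kx zr.
  have qy := quadE xi; rewrite yE in qy.
  have -> : ve b (eps *: z) = eps * v b z by rewrite /ve scalerA mulVf// scale1r.
  rewrite qy quadE (_ : ve b y = eps * v b xi)// => h.
  by rewrite -(ler_pM2l e0); lra.
(* For frozen [y], the penalization contributes the same [q] to the slope of the test function for
   [u]. *)
have test := C1_closure_quad (- A) y cphi3.
have [||] := @su b eps e0 _ _ x test Kx.
- by move=> x' Kx'; have := xymin b x' y Kx' ry; rewrite /w; lra.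
- have coup : eps^-1 * (u b eps x - u (~~ b) eps x) <= v b xi - v (~~ b) xi.
    have := xymin (~~ b) x y Kx ry; rewrite /w /ve -/xi => h.
    by rewrite mulrC ler_pdivrMr//; lra.
  rewrite /system_eq mulNrn scaleNr -/q => h; left.
  lra.
by right.
Qed.

(** Subtracting the cell inequality from the one for [u] bounds [0] by [u b eps x + Hbar P] plus a
    difference of values of [H] at nearby arguments, whereas [m x0 + Hbar P = - kappa]. One half of
    [kappa] absorbs the error in [u], the other the error in [H]. *)
Lemma homogenized_super phi Dphi x0 :
  C1_closure Om phi Dphi -> closure Om x0 -> cont_on (closure Om) m ->
  (forall x, closure Om x -> m x0 - phi x0 <= m x - phi x) ->
  0 <= m x0 + Hbar (Dphi x0) \/ (boundary Om x0 /\ exists b, g b x0 <= m x0).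
Proof.
move=> cphi Kx0 cm mmin.
have [//|nbdry] := pselect (boundary Om x0 /\ exists b, g b x0 <= m x0).
  by right.
left; rewrite leNgt; apply/negP => neg.
pose P := Dphi x0; pose kappa : R := - (m x0 + Hbar P).
have kappaE : kappa = - (m x0 + Hbar P) by [].
have kappa0 : 0 < kappa by rewrite kappaE /P; lra.
clearbody kappa; clear neg.
have [v [V [V0 cv vV vsol]]] := cell P.
have [r1 r10 r1P] : exists2 r : R, 0 < r & exists2 beta : R, 0 < beta &
    forall b x, boundary Om x -> `|x - x0| < r -> m x0 + beta < g b x.
  have [Ox0|nOx0] := pselect (Om x0).
    have [r r0 rP] := open_normE oOm Ox0; exists r => //; exists 1 => //.
    by move=> b x [_ nOx] /rP.
  have bx0 : boundary Om x0 by [].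
  have gm b : m x0 < g b x0.
    by rewrite ltNge; apply/negP => h; apply: nbdry; split=> //; exists b.
  pose beta := Num.min (g true x0 - m x0) (g false x0 - m x0) / 2.
  have beta0 : 0 < beta by rewrite divr_gt0// lt_min !subr_gt0 !gm.
  have beta_le b : beta * 2 <= g b x0 - m x0.
    by rewrite /beta divfK//; case: b; rewrite ge_min lexx ?orbT.
  have [||r r0 rP] := @bool_uniform R 'rV[R]_n (fun b r x => boundary Om x ->
    `|x - x0| < r -> `|g b x - g b x0| < beta).
  - by move=> b x d d' dd' H0 bx xx0; apply: H0 => //; exact: lt_le_trans dd'.
  - by move=> b; have [d d0 dP] := @cg b x0 bx0 beta beta0; exists d.
  exists r => //; exists beta => // b x bx xx0.
  have /ltr_normlP[h1 h2] := rP b x bx xx0; have := beta_le b; lra.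
have [beta' beta'0 beta'P] := r1P.
(* Once [u b eps x <= m x0 + beta], the boundary alternative near [x0] is excluded. *)
pose beta := Num.min beta' (kappa / 2).
have beta0 : 0 < beta by rewrite lt_min beta'0; lra.
have betaP b x : boundary Om x -> `|x - x0| < r1 -> m x0 + beta < g b x.
  move=> bx xx0; apply: le_lt_trans (beta'P b x bx xx0).
  by rewrite lerD2l ge_min lexx.
have betak : beta <= kappa / 2 by rewrite ge_min lexx orbT.
clearbody beta; clear beta' beta'0 beta'P.
(* The two premises are what the cell inequality and the inequality for [u] give, as correctors
   differ by at most [2 * V]. [Hunif] asks for one bounded momentum, so either conclusion
   suffices. *)
have [Q QP] : exists Q : R, forall b xi xi' p p',
    H b xi p <= Hbar P + 2 * V -> - (m x0 + beta) - 2 * V <= H b xi' p' ->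
    `|p| <= Q \/ `|p'| <= Q.
  case: Hcoercive => coer.
    have [Q1 Q1P] := coer true (Hbar P + 2 * V).
    have [Q2 Q2P] := coer false (Hbar P + 2 * V).
    exists (Num.max Q1 Q2) => b xi xi' p p' h _; left; rewrite le_max.
    by case: b h => [/Q1P ->|/Q2P ->]; rewrite ?orbT.
  have [Q1 Q1P] := coer true (- (m x0 + beta) - 2 * V).
  have [Q2 Q2P] := coer false (- (m x0 + beta) - 2 * V).
  exists (Num.max Q1 Q2) => b xi xi' p p' _ h; right; rewrite le_max.
  by case: b h => [/Q1P ->|/Q2P ->]; rewrite ?orbT.
have k2 : 0 < kappa / 2 by lra.
have [d d0 dP] : exists2 d : R, 0 < d & forall b xi xi' p p', `|p| <= Q ->
    `|xi' - xi| < d -> `|p' - p| < d -> `|H b xi' p' - H b xi p| < kappa / 2.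
  have [d1 d10 d1P] := Hunif true Q k2; have [d2 d20 d2P] := Hunif false Q k2.
  exists (Num.min d1 d2); first by rewrite lt_min d10.
  move=> b xi xi' p p' pQ; rewrite !lt_min => /andP[a1 a2] /andP[a3 a4].
  by case: b; [exact: d1P|exact: d2P].
have [/within_continuousE cphi1 /within_continuousE cphi2 _] := cphi.
have [|r2 r20 r2P] := cphi1 x0 Kx0 (beta / 4); first lra.
have [|r3 r30 r3P] := cphi2 x0 Kx0 (d / 2); first lra.
pose r := Num.min (Num.min r1 r2) (Num.min r3 (d / 4)).
have r0 : 0 < r by rewrite !lt_min r10 r20 r30; lra.
(* Comparison with [x0] will give [dotv (x - x0) (x - x0) <= 2 * eta + s < r ^+ 2]; quarters of
   [beta] for [s], [eta] and the variation of [phi] keep [u b eps x] below [m x0 + beta]. *)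
pose s := Num.min (Num.min (r ^+ 2 / 2) (beta / 4)) (Num.min (d ^+ 2) 1).
have rr0 : 0 < r ^+ 2 by exact: exprn_gt0.
have dd0 : 0 < d ^+ 2 by exact: exprn_gt0.
have s0 : 0 < s by rewrite !lt_min dd0 ltr01 !andbT; apply/andP; split; lra.
have [s1 [s2 [s3 s4]]] : s <= r ^+ 2 / 2 /\ s <= beta / 4 /\ s <= d ^+ 2 /\ s <= 1.
  by rewrite /s !ge_min !lexx ?orbT.
clearbody s.
pose eta := Num.min (r ^+ 2 / 8) (beta / 4).
have eta0 : 0 < eta by rewrite lt_min; apply/andP; split; lra.
have [e1 e2] : eta <= r ^+ 2 / 8 /\ eta <= beta / 4.
  by rewrite /eta !ge_min !lexx ?orbT.
clearbody eta.
have [d1 d10 mlowP] := mlow eta0.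
have V1 : 0 < 2 * V + 1 by lra.
have [|eps [eps0]] := @mfreq x0 eta
  (Num.min d1 (Num.min 1 (s / (2 * V + 1)))) Kx0 eta0.
  by rewrite !lt_min d10 ltr01 divr_gt0.
rewrite !lt_min => /and3P[epsd eps1 epss] ux0.
rewrite ltr_pdivlMr// mulrC in epss.
have Ves : 2 * V * eps < s by rewrite mulrDl mul1r in epss; lra.
have [b [x [xi [q [Kx xxi umin vineq uineq]]]]] :=
  perturbed_test cphi Kx0 cv vV vsol eps0 eps1 V0 Ves s4.
have := umin true x0 Kx0; rewrite subrr dotv00 addr0 => ux.
have mx := mmin x Kx; have lowx := mlowP b x eps Kx eps0 epsd.
have xr : `|x - x0| < r.
  suff : `|x - x0| ^+ 2 < r ^+ 2 by rewrite ltr_sqr ?nnegrE// ltW.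
  by apply: le_lt_trans (norm_sqr_le_dotv _) _; lra.
clear epss epsd eps0 eps1 d10 V1 V0 Ves s0 dd0 rr0 eta0 s1 s4 e1.
have q0 := dotv_ge0 (x - x0).
move: xr; rewrite !lt_min => /andP[/andP[xr1 xr2] /andP[xr3 xr4]].
have /ltr_normlP[ph1 ph2] := r2P x Kx xr2.
have ubx : u b eps x <= m x0 + beta by lra.
case: uineq => [uineq|[bx]]; last by have := betaP b x bx xr1; lra.
have /ler_normlP[v1 v2] := vV b xi; have /ler_normlP[v3 v4] := vV (~~ b) xi.
pose p' := Dphi x - 2 *: (x - x0) + q.
have xid : `|eps^-1 *: x - xi| < d.
  suff : `|eps^-1 *: x - xi| ^+ 2 < d ^+ 2 by rewrite ltr_sqr ?nnegrE// ltW.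
  exact: lt_le_trans s3.
have pp' : `|p' - (P + q)| < d.
  have -> : p' - (P + q) = (Dphi x - P) - 2 *: (x - x0).
    by rewrite /p' opprD addrACA subrr addr0 addrAC.
  apply: le_lt_trans (ler_normB _ _) _; rewrite normrZ ger0_norm//.
  have := r3P x Kx xr3; rewrite -/P; lra.
have hH : `|H b (eps^-1 *: x) p' - H b xi (P + q)| < kappa / 2.
  have [||pQ|pQ] := QP b xi (eps^-1 *: x) (P + q) p'; [lra|rewrite /p'; lra|..].
    exact: dP.
  by rewrite distrC; apply: dP => //; rewrite distrC.
move/ltr_normlP: hH => [h1 h2].
rewrite -/p' in uineq; lra.
Qed.

End HomogenizedSupersolution.

(** * Convergence *)

Section Convergence.
Variables (R : realType) (n : nat) (Om : set 'rV[R]_n).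
Hypothesis hOm : lipschitz_domain Om.
Variables (H : bool -> 'rV[R]_n -> 'rV[R]_n -> R) (Hbar : 'rV[R]_n -> R).
Variables (g : bool -> 'rV[R]_n -> R) (u : bool -> R -> 'rV[R]_n -> R).
Hypothesis hH : forall b, hamiltonian (H b).
Hypothesis cell : forall P, exists (v : bool -> 'rV[R]_n -> R) (V : R),
  [/\ 0 <= V, forall b, continuous (v b), forall b xi, `|v b xi| <= V &
    forall b, viscosity_solution (cell_eq (H b) P (Hbar P) (v (~~ b))) (v b)].
Hypothesis cg : forall b, cont_on (boundary Om) (g b).
Hypothesis hu : forall b (eps : R), 0 < eps ->
  dirichlet_solution Om (system_eq (H b) eps (u (~~ b) eps)) (g b) (u b eps).

Let oOm : open Om. Proof. by case: hOm. Qed.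
Let bOm : bounded_set Om. Proof. by case: hOm. Qed.
Let lipOm : lipschitz_boundary Om. Proof. by case: hOm. Qed.
Let cK : compact (closure Om). Proof. exact: compact_closure_bounded. Qed.

Let cu b (eps : R) : 0 < eps -> cont_on (closure Om) (u b eps).
Proof. by move=> /(hu b)[/within_continuousE]. Qed.

Lemma boundary_bounded (f : 'rV[R]_n -> R) : cont_on (boundary Om) f ->
  exists2 C : R, 0 <= C & forall x, boundary Om x -> `|f x| <= C.
Proof.
move=> cf; have [[x bx]|nbd] := pselect (boundary Om !=set0); last first.
  by exists 0 => // x bx; exfalso; apply: nbd; exists x.
have cbd : compact (boundary Om).
  apply: subclosed_compact cK _; last by move=> y [].
  rewrite /boundary setDE.
  by apply: closedI; [exact: closed_closure|exact: open_closedC].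
have [||c bc cP] := @compact_max R _ _ (fun x => `|f x|) _ cbd.
- by exists x.
- exact: cont_on_norm.
by exists `|f c|.
Qed.

Lemma data_bounds : exists2 C : R, 0 <= C & forall b,
  [/\ forall xi, `|H b xi 0| <= C, forall xi p, - C <= H b xi p &
    forall x, boundary Om x -> `|g b x| <= C].
Proof.
have bnd b : exists2 C : R, 0 <= C &
    [/\ forall xi, `|H b xi 0| <= C, forall xi p, - C <= H b xi p &
      forall x, boundary Om x -> `|g b x| <= C].
  have [C1 C10 C1P] := hamiltonian_bounded (hH b) 0.
  have [C2 C20 C2P] := hamiltonian_bounded_below (hH b).
  have [C3 C30 C3P] := boundary_bounded (@cg b).
  exists (C1 + C2 + C3); first by rewrite !addr_ge0.
  split.
  - by move=> xi; have := C1P xi 0; rewrite normr0 => /(_ (lexx _)); lra.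
  - by move=> xi p; have := C2P xi p; lra.
  - by move=> x bx; have := C3P x bx; lra.
have [C C0 [a1 a2 a3]] := bnd true; have [D D0 [b1 b2 b3]] := bnd false.
exists (C + D); first by rewrite addr_ge0.
case; split=> *.
- by apply: (le_trans (a1 _)); lra.
- by apply: le_trans (a2 _ _); lra.
- by apply: (le_trans (a3 _ _)) => //; lra.
- by apply: (le_trans (b1 _)); lra.
- by apply: le_trans (b2 _ _); lra.
- by apply: (le_trans (b3 _ _)) => //; lra.
Qed.

Lemma reflected_super b (eps : R) : 0 < eps ->
  dirichlet_super Om
    (system_eq (reflect_ham (H b)) eps (fun x => - u (~~ b) eps x))
    (fun x => - g b x) (fun x => - u b eps x).
Proof.
move=> e0; have [_ /dirichlet_super_reflect] := hu b e0.
by rewrite system_eq_reflect.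
Qed.

Lemma solution_bounds : exists2 C : R, 0 <= C &
  (forall b eps x, 0 < eps -> closure Om x -> `|u b eps x| <= C) /\
  (forall b xi p, - C <= H b xi p).
Proof.
have [C C0 CP] := data_bounds; exists C => //; split; last first.
  by move=> b; case: (CP b).
move=> b eps x e0 Kx.
have low : - C <= u b eps x.
  apply: (@super_lower_bound R n Om cK H g (fun b => u b eps) eps C e0) => //.
  - by move=> b'; exact: cu.
  - by move=> b'; case: (hu b' e0).
  - move=> b' xi; have [/(_ xi) h _ _] := CP b'.
    by apply: le_trans h; exact: ler_norm.
  - by move=> b' y by'; have [_ _ /(_ y by')/ler_normlP[]] := CP b'; lra.
have up : - C <= - u b eps x.
  apply: (@super_lower_bound R n Om cK (fun b => reflect_ham (H b))
    (fun b x => - g b x) (fun b x => - u b eps x) eps C e0 _ _ _ _ b x) => //.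
  - by move=> b'; exact/cont_onN/cu.
  - by move=> b'; exact: reflected_super.
  - move=> b' xi; have [/(_ xi)/ler_normlP[h _] _ _] := CP b'.
    by rewrite /reflect_ham oppr0.
  - by move=> b' y by'; have [_ _ /(_ y by')/ler_normlP[]] := CP b'; lra.
by rewrite ler_norml low /=; lra.
Qed.

(** Each component, as a subsolution, bounds the gap from one side. *)
Lemma gap_bound : exists2 C : R, 0 <= C & forall b eps x, 0 < eps ->
  closure Om x -> `|u b eps x - u (~~ b) eps x| <= C * eps.
Proof.
have [C C0 [uC HC]] := solution_bounds; exists (2 * C); first lra.
have gap b eps x : 0 < eps -> closure Om x ->
    u b eps x - u (~~ b) eps x <= 2 * C * eps.
  move=> e0; have [_ sub _] := hu b e0.
  exact: (sub_gap cK oOm e0 C0 (cu b e0) (cu (~~ b) e0) sub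
    (fun x => uC b eps x e0) (HC b)).
move=> b eps x e0 Kx; have h1 := gap b eps x e0 Kx.
have := gap (~~ b) eps x e0 Kx; rewrite negbK => h2.
by rewrite ler_norml; apply/andP; split; lra.
Qed.

Lemma equicontinuity z (eta : R) : closure Om z -> 0 < eta ->
  exists2 r : R, 0 < r & forall b eps x, 0 < eps -> closure Om x ->
    `|x - z| < r -> `|u b eps x - u b eps z| <= eta.
Proof.
move=> Kz eta0.
have [C C0 [uC HC]] := solution_bounds; have [D D0 gap] := gap_bound.
pose B := C + D; have B0 : 0 <= B by rewrite addr_ge0.
have [Q Q0 QP] : exists2 Q : R, 0 < Q &
    forall b xi p, H b xi p <= 3 * B -> `|p| <= Q.
  have [Q1 Q10 Q1P] := hamiltonian_coercive (hH true) (3 * B).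
  have [Q2 Q20 Q2P] := hamiltonian_coercive (hH false) (3 * B).
  exists (Q1 + Q2); first exact: addr_gt0.
  by case=> xi p => [/Q1P|/Q2P]; lra.
have [r r0 [L L0 rP]] := equilipschitz oOm lipOm cK Kz.
have M0 : 0 < L * (n%:R * Q) + 1 by rewrite ltr_wpDl// mulr_ge0// mulr_ge0// ltW.
exists (Num.min r (eta / (L * (n%:R * Q) + 1))).
  by rewrite lt_min r0 divr_gt0.
move=> b eps x e0 Kx; rewrite lt_min => /andP[xr].
rewrite ltr_pdivlMr// => xeta.
have touch : touching_bound Om (u b eps) Q.
  have [_ sub _] := hu b e0.
  apply: (sub_touching_bound (C := B) e0 sub) => //.
  - by move=> y Ky; have := uC b eps y e0 Ky; rewrite /B; lra.
  - move=> y Ky; have /ler_normlP[h _] := gap b eps y e0 Ky.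
    have : D * eps <= 2 * B * eps by rewrite ler_pM2r// /B; lra.
    lra.
  - exact: QP.
have uCe y := uC b eps y e0.
apply: (le_trans (rP _ C Q C0 (ltW Q0) (cu b e0) uCe touch x Kx xr)).
apply: le_trans (ltW xeta); rewrite mulrC ler_wpM2l//; lra.
Qed.

(** The gap bound keeps the coupling term above [- D], so the inequality of the equation alone
    bounds the slope and the barrier applies. *)
Lemma solution_le_boundary b (eps : R) x : 0 < eps -> boundary Om x ->
  u b eps x <= g b x.
Proof.
move=> e0 bx; have [C C0 [uC HC]] := solution_bounds; have [D D0 gap] := gap_bound.
have [Q Q0 QP] := hamiltonian_coercive (hH b) (C + D).
have [_ sub _] := hu b e0.
apply: (@sub_boundary_le R n Om lipOm _ (g b) (u b eps) C Q x cK C0 Q0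
  (cu b e0) (@cg b) _ _ sub bx).
- by move=> y; exact: uC.
- move=> y p Ky; rewrite /system_eq => h; apply: (QP (eps^-1 *: y)).
  have /ler_normlP[h1 _] := uC b eps y e0 Ky.
  have /ler_normlP[h2 _] := gap b eps y e0 Ky.
  have : - (eps^-1 * (u b eps y - u (~~ b) eps y)) <= D.
    by rewrite -mulrN mulrC ler_pdivrMr.
  lra.
Qed.

Let gmin x := Num.min (g true x) (g false x).

Lemma liminf_super m : cont_on (closure Om) m ->
  is_liminf (closure Om) (u true) m ->
  dirichlet_super Om (limit_eq Hbar) gmin m.
Proof.
move=> cm [mlow mfreq] phi Dphi x0 cphi Kx0 mmin.
have [D D0 gap] := gap_bound.
have [] := @homogenized_super R n Om H Hbar g u m oOm bOm _ _ cell cg cu _ _ _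
  phi Dphi x0 cphi Kx0 cm mmin.
- by move=> b Q eta; exact: hamiltonian_uniform.
- left=> b M; have [Q _ QP] := hamiltonian_coercive (hH b) M.
  by exists Q.
- by move=> b eps e0; case: (hu b e0).
- move=> eta eta0; have [|d d0 dP] := mlow (eta / 2); first lra.
  have D1 : 0 < 2 * D + 1 by lra.
  (* At these scales [D * eps] is at most [eta / 2], so the bound for [true] passes to [false]. *)
  exists (Num.min d (eta / (2 * D + 1))); first by rewrite lt_min d0 divr_gt0.
  move=> b x eps Kx e0; rewrite lt_min ltr_pdivlMr// => /andP[ed eeta].
  have h1 := dP x eps Kx e0 ed; case: b; first lra.
  have /ler_normlP[h2 h3] := gap true eps x e0 Kx; rewrite /= in h2 h3; lra.
- by move=> x eta d; exact: mfreq.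
- by left.
- move=> [bx [b gb]]; right; split=> //; rewrite ge_min.
  by case: b gb => ->; rewrite ?orbT.
Qed.

Lemma limsup_sub m' : cont_on (closure Om) m' ->
  is_liminf (closure Om) (fun eps x => - u true eps x) m' ->
  dirichlet_sub Om (limit_eq Hbar) gmin (fun x => - m' x).
Proof.
move=> cm [mlow mfreq]; have [D D0 gap] := gap_bound.
suff : dirichlet_super Om (limit_eq (fun p => - Hbar (- p)))
    (fun x => - gmin x) m'.
  rewrite -limit_eq_reflect => sup; apply: dirichlet_sub_reflect.
  by rewrite (_ : (fun x => - - m' x) = m')//; apply/funext => x; rewrite opprK.
move=> phi Dphi x0 cphi Kx0 mmin.
have mlow' : forall eta : R, 0 < eta -> exists2 d : R, 0 < d &
    forall b x eps, closure Om x -> 0 < eps -> eps < d ->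
      m' x - eta <= - u b eps x.
  move=> eta eta0; have [|d d0 dP] := mlow (eta / 2); first lra.
  have D1 : 0 < 2 * D + 1 by lra.
  exists (Num.min d (eta / (2 * D + 1))); first by rewrite lt_min d0 divr_gt0.
  move=> b x eps Kx e0; rewrite lt_min ltr_pdivlMr// => /andP[ed eeta].
  have h1 : m' x - eta / 2 <= - u true eps x := dP x eps Kx e0 ed; case: b; first lra.
  have /ler_normlP[h2 h3] := gap true eps x e0 Kx; rewrite /= in h2 h3; lra.
(* At a boundary point, take a small scale at which [u true eps x0] nearly reaches [- m' x0]: both
   [u b eps x0 <= g b x0] hold and the gap is small, so [- m' x0] lies below both data. *)
have [Ox0|nOx0] := pselect (Om x0); last first.
  right; split=> //; rewrite lerNl; apply/ler_addgt0Pr => eta eta0.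
  have D1 : 0 < 2 * D + 1 by lra.
  have [||eps [e0]] := mfreq x0 (eta / 2) (eta / (2 * D + 1)) Kx0.
  - by rewrite divr_gt0.
  - by rewrite divr_gt0.
  rewrite ltr_pdivlMr// => eeta ux.
  have bx0 : boundary Om x0 by [].
  have h b : - m' x0 <= g b x0 + eta.
    have := solution_le_boundary b e0 bx0.
    case: b; first lra.
    have /ler_normlP[h2 h3] := gap true eps x0 e0 Kx0; rewrite /= in h2 h3; lra.
  by rewrite /gmin minElt; case: ifP => _; exact: h.
left.
have [] := @homogenized_super R n Om (fun b => reflect_ham (H b))
  (fun p => - Hbar (- p)) (fun b x => - g b x) (fun b eps x => - u b eps x) m'
  oOm bOm _ _ _ _ _ _ mlow' _ phi Dphi x0 cphi Kx0 cm mmin.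
- move=> b Q eta eta0; have [d d0 dP] := hamiltonian_uniform (hH b) Q eta0.
  exists d => // xi xi' p p' pQ xx pp; rewrite /reflect_ham -opprD normrN.
  by apply: dP; rewrite ?normrN// -opprD normrN.
- right=> b M; have [Q _ QP] := hamiltonian_coercive (hH b) (- M).
  by exists Q => xi p; rewrite /reflect_ham lerNr => /QP; rewrite normrN.
- move=> P; have [v [V [V0 cv vV vsol]]] := cell (- P).
  exists (fun b x => - v b x), V; split=> //.
  + by move=> b x; apply: continuousN; exact: cv.
  + by move=> b xi; rewrite normrN.
  + move=> b; have := viscosity_solution_reflect (vsol b).
    by rewrite cell_eq_reflect opprK.
- by move=> b; exact/cont_onN/cg.
- by move=> b eps e0; exact/cont_onN/cu.
- by move=> b eps e0; exact: reflected_super.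
- by move=> x eta d; exact: mfreq.
- by [].
- by move=> [[]].
Qed.

Hypothesis hcomp : comparison_principle Om (limit_eq Hbar) gmin.

(** [- m'] is the upper limit of [u true]. Comparison gives [- m' <= m], and a single small scale
    gives the converse up to [eta]; once the limits agree, convergence is uniform up to the
    boundary. *)
Lemma uniform_limit : exists2 m, dirichlet_solution Om (limit_eq Hbar) gmin m &
  forall eta : R, 0 < eta -> exists2 d : R, 0 < d & forall b x eps,
    closure Om x -> 0 < eps -> eps < d -> `|u b eps x - m x| <= eta.
Proof.
have [C C0 [uC _]] := solution_bounds; have [D D0 gap] := gap_bound.
have [m [cm lm]] := @liminf_equicontinuous R 'rV[R]_n (closure Om) (u true) C cK
  (fun eps x => uC true eps x)
  (fun z eta Kz eta0 => let: ex_intro2 r r0 rP := equicontinuity Kz eta0 in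
     ex_intro2 _ _ r r0 (rP true)).
have [||m' [cm' lm']] := @liminf_equicontinuous R 'rV[R]_n (closure Om)
  (fun eps x => - u true eps x) C cK.
- by move=> eps x e0 Kx; rewrite normrN; exact: uC.
- move=> z eta Kz eta0; have [r r0 rP] := equicontinuity Kz eta0.
  by exists r => // eps x e0 Kx xz; rewrite -opprD normrN; exact: rP.
have sup := liminf_super cm lm; have sub := limsup_sub cm' lm'.
have le x : closure Om x -> - m' x <= m x.
  move=> Kx; apply: (hcomp _ _ sub sup Kx); apply/within_continuousE => //.
  exact: cont_onN.
have both eta : 0 < eta -> exists2 d : R, 0 < d & forall x eps, closure Om x ->
    0 < eps -> eps < d -> m x - eta <= u true eps x <= - m' x + eta.
  move=> eta0; have [d d0 dP] := lm.1 eta eta0; have [d' d'0 d'P] := lm'.1 eta eta0.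
  exists (Num.min d d'); first by rewrite lt_min d0.
  move=> x eps Kx e0; rewrite lt_min => /andP[ed ed'].
  have := dP x eps Kx e0 ed; have := d'P x eps Kx e0 ed' => h1 h2.
  by apply/andP; split; lra.
have eqm x : closure Om x -> - m' x = m x.
  move=> Kx; apply/eqP; rewrite eq_le le//=; apply/ler_addgt0Pr => eta eta0.
  have [|d d0 dP] := both (eta / 2); first lra.
  have [d2 d2d] : 0 < d / 2 /\ d / 2 < d by split; lra.
  have /andP[] := dP x (d / 2) Kx d2 d2d; lra.
exists m.
  split=> //; first exact/within_continuousE.
  (* [m] and [- m'] are known to agree on the closure, so the subsolution property is transferred
     pointwise there. *)
  move=> phi Dphi x0 cphi Kx0 mmax; rewrite -(eqm _ Kx0).
  by apply: (sub phi Dphi) => // x Kx; rewrite !eqm//; exact: mmax.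
move=> eta eta0; have [|d d0 dP] := both (eta / 2); first lra.
have D1 : 0 < 2 * D + 1 by lra.
exists (Num.min d (eta / (2 * D + 1))); first by rewrite lt_min d0 divr_gt0.
move=> b x eps Kx e0; rewrite lt_min ltr_pdivlMr// => /andP[ed eeta].
have /andP[] := dP x eps Kx e0 ed; rewrite eqm// => h1 h2.
have /ler_normlP[h3 h4] := gap true eps x e0 Kx; rewrite /= in h3 h4.
have De : 0 <= D * eps by rewrite mulr_ge0// ltW.
by rewrite ler_norml; apply/andP; case: b; split; lra.
Qed.

End Convergence.

Lemma uniform_cvg_at0 (R : realType) (n : nat) (K : set 'rV[R]_n)
    (w : R -> 'rV[R]_n -> R) (m : 'rV[R]_n -> R) :
  (forall eta : R, 0 < eta -> exists2 d : R, 0 < d & forall x eps,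
    K x -> 0 < eps -> eps < d -> `|w eps x - m x| <= eta) ->
  {uniform K, w eps @[eps --> 0^'+] --> m}.
Proof.
move=> H P /uniform_nbhs[E [entE EP]].
move: entE; rewrite -entourage_ballE => -[e e0 eE].
have [|d d0 dP] := H (e / 2); first by rewrite divr_gt0.
apply: (@filterS _ _ _ [set eps | 0 < eps < d]).
  move=> eps /= /andP[eps0 epsd]; apply: EP => x Kx; apply: eE.
  rewrite /= -ball_normE /= distrC; apply: (le_lt_trans (dP x eps Kx eps0 epsd)).
  by rewrite ltr_pdivrMr// ltr_pMr// ltr1n.
near=> eps; apply/andP; split; near: eps; first exact: nbhs_right_gt.
exact: nbhs_right_lt.
Unshelve. all: end_near. Qed.

Theorem theorem6p1 (R : realType) (n : nat) (Om : set 'rV[R]_n)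
    (H1 H2 : 'rV[R]_n -> 'rV[R]_n -> R) (Hbar : 'rV[R]_n -> R)
    (g1 g2 : 'rV[R]_n -> R) (u1 u2 : R -> 'rV[R]_n -> R)
    (hOm : lipschitz_domain Om)
    (hH1 : hamiltonian H1) (hH2 : hamiltonian H2)
    (hHbar : effective_hamiltonian H1 H2 Hbar)
    (hg1 : {within boundary Om, continuous g1})
    (hg2 : {within boundary Om, continuous g2})
    (hcomp : comparison_principle Om (limit_eq Hbar)
               (fun x => Num.min (g1 x) (g2 x)))
    (hu : forall eps : R, 0 < eps ->
            system_solution Om H1 H2 g1 g2 eps (u1 eps) (u2 eps)) :
  exists u : 'rV[R]_n -> R,
    [/\ cvg_locally_uniformly Om u1 u,
        cvg_locally_uniformly Om u2 u &
        dirichlet_solution Om (limit_eq Hbar)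
          (fun x => Num.min (g1 x) (g2 x)) u].
Proof.
(* Indexing by booleans makes both equations instances of one, [~~ b] being the other component. *)
pose H b := if b then H1 else H2; pose g b := if b then g1 else g2.
pose u b := if b then u1 else u2.
have hH b : hamiltonian (H b) by case: b.
have cell P : exists (v : bool -> 'rV[R]_n -> R) (V : R),
    [/\ 0 <= V, forall b, continuous (v b), forall b xi, `|v b xi| <= V &
      forall b, viscosity_solution (cell_eq (H b) P (Hbar P) (v (~~ b))) (v b)].
  have [[v1 [v2 [[cv1 cv2] [pv1 pv2] s1 s2]]] _] := hHbar P.
  have [V1 V10 V1P] := Zperiodic_bounded cv1 pv1.
  have [V2 V20 V2P] := Zperiodic_bounded cv2 pv2.
  exists (fun b => if b then v1 else v2), (V1 + V2); split; try by case.
    exact: addr_ge0.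
  by case=> xi; [have := V1P xi|have := V2P xi]; lra.
have cg b : cont_on (boundary Om) (g b).
  by case: b; exact/within_continuousE.
have hub b eps : 0 < eps ->
    dirichlet_solution Om (system_eq (H b) eps (u (~~ b) eps)) (g b) (u b eps).
  by move=> /hu[]; case: b.
have [m msol mP] := uniform_limit hOm hH cell cg hub hcomp.
have cvg b : cvg_locally_uniformly Om (u b) m.
  move=> K _ KOm; apply: uniform_cvg_at0 => eta /mP[d d0 dP].
  by exists d => // x eps /KOm/subset_closure Kx; exact: dP.
by exists m; split; [exact: (cvg true)|exact: (cvg false)|].
Qed.
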